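(* Let $N\ge 1$ and consider the PT chain on permutation tableaux of half-perimeter $N+1$ with parameters $\alpha,\beta,q$. Let $\mathcal T$ be a permutation tableau of half-perimeter $N+1$. Then the steady state probability of finding the PT chain in state $\mathcal T$ is $$\frac{\mathrm{wt}(\mathcal T)}{\sum_{\mathcal S}\mathrm{wt}(\mathcal S)},$$ where the sum is over all permutation tableaux $\mathcal S$ of half-perimeter $N+1$.
   Context: Parameters: $\alpha,\beta>0$ and $q\ge 0$ are real numbers such that all transition probabilities below (including the probabilities of staying put) lie in $[0,1]$ (e.g. $0<\alpha,\beta\le 1$, $0\le q\le 1$); $q^0=1$. The steady state is the stationary distribution of the chain. Permutation tableaux. A partition $\lambda=(\lambda_1\ge\dots\ge\lambda_t)$, $t\ge 1$, is a weakly decreasing sequence of nonnegative integers (parts equal to $0$ are allowed and are counted as rows). Its Young diagram $Y_\lambda$ is left-justified with $\lambda_i$ boxes in row $i$ (rows numbered from top to bottom); it has $t$ rows and $\lambda_1$ columns, and its half-perimeter is (number of rows) + (number of columns) $=t+\lambda_1$. The length of a row or column is its number of boxes. A permutation tableau of shape $\lambda$ is a filling of the boxes of $Y_\lambda$ with $0$'s and $1$'s such that (1) each column contains at least one $1$; (2) there is no $0$ which has both a $1$ above it in the same column and a $1$ to its left in the same row. The half-perimeter of a tableau is that of its shape. Statistics. A $1$ is topmost if it has only $0$'s above it in its column, superfluous if it is not topmost, and necessary if it is the unique $1$ in its column. $\mathrm{rk}(\mathcal T)$ is the number of superfluous $1$'s. $f(\mathcal T)$ is the number of $1$'s in the first row.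 A $0$ is restricted if there is a $1$ above it in the same column; a row is unrestricted if it contains no restricted $0$. $u(\mathcal T)$ is the number of unrestricted rows minus $1$. The weight is $\mathrm{wt}(\mathcal T)=q^{\mathrm{rk}(\mathcal T)}\alpha^{-f(\mathcal T)}\beta^{-u(\mathcal T)}$. The PT chain is the Markov chain whose states are the permutation tableaux of half-perimeter $N+1$ and whose transitions from a tableau $\mathcal S$ of shape $\lambda=(\lambda_1,\dots,\lambda_t)$ are the following (inserting a row ''as far south as possible'' means below all rows of length at least that of the new row; inserting a column ''as far east as possible'' means to the right of all columns of length at least that of the new column). (a) Particle enters from the left. If the rightmost column of $\mathcal S$ exists and has length $1$: delete this column and insert a new all-zero row of length $\lambda_1-1$ as far south as possible. Probability $\alpha/(N+1)$. (b) Particle hops right. For every $j\ge 2$ with $\lambda_j>\lambda_{j+1}$ (where $\lambda_{t+1}:=0$) there is one transition, of probability $1/(N+1)$, to the tableau $\mathcal T$ obtained as follows. Case 1: if the rightmost entry of row $j$ is $0$ (then row $j$ is all zeros), delete row $j$ and insert a new row of $\lambda_j-1$ zeros as far south as possible. Case 2: if the rightmost entry of row $j$ is a superfluous $1$, delete that box (so row $j$ gets length $\lambda_j-1$). Case 3: if the rightmost entry of row $j$ is a necessary $1$, delete the column containing it (which has length $j$) and insert, as far east as possible, a new column of length $j-1$ consisting of $0$'s except for a $1$ in its bottom box. (c) Particle exits to the right. If $t\ge 2$ and $\lambda_t=0$: delete row $t$ and insert, as far to the right as possible, a new column of length $t-1$ consisting (top to bottom) of $t-2$ zeros followed by a $1$.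 Probability $\beta/(N+1)$. (d) Particle hops left. For every $1\le j\le t-1$ with $\lambda_j>\lambda_{j+1}$: increase the length of row $j+1$ by $1$ and fill the new box with a $1$. Probability $q/(N+1)$. All other transitions between distinct states have probability $0$, and with the remaining probability the chain stays in its current state. *)

(* Defs.v *)
From HB Require Import structures.
From mathcomp Require Import all_boot all_order all_algebra.

Set Implicit Arguments.
Unset Strict Implicit.
Unset Printing Implicit Defensive.

Import Order.TTheory GRing.Theory Num.Theory.

(* A filling of a Young diagram is the list of its rows from top to bottom, an
   entry 1 being [true].  Zero parts of the shape are empty rows [::].  Rows and
   columns are indexed from 0, so row i here is row i+1 of the usual
   convention. *)
Notation filling := (seq (seq bool)).

Section Fillings.
Implicit Types (T : filling) (i j : nat).

Definition nrows T := size T.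
Definition ncols T := size (head [::] T).
Definition half_perimeter T := nrows T + ncols T.

(* Beyond the last row the length is 0. *)
Definition row_length T i := size (nth [::] T i).
Definition col_length T j := count (fun r => j < size r) T.

Definition boxes T : seq (nat * nat) :=
  [seq (i, j) | i <- iota 0 (nrows T), j <- iota 0 (row_length T i)].

(* False outside the diagram. *)
Definition is_one T i j := nth false (nth [::] T i) j.
Definition is_zero T i j := (j < row_length T i) && ~~ is_one T i j.

Definition one_above T i j := has (fun i' => is_one T i' j) (iota 0 i).
Definition one_left T i j := has (fun j' => is_one T i j') (iota 0 j).

Definition is_permutation_tableau T :=
  [&& 0 < nrows T,
      sorted geq (map size T),
      all (fun j => has (fun i => is_one T i j) (iota 0 (nrows T)))
          (iota 0 (ncols T))
    & all (fun b => ~~ [&& is_zero T b.1 b.2, one_above T b.1 b.2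
                         & one_left T b.1 b.2]) (boxes T)].

Definition topmost T i j := is_one T i j && ~~ one_above T i j.
Definition superfluous T i j := is_one T i j && ~~ topmost T i j.
Definition necessary T i j :=
  is_one T i j && (count (fun i' => is_one T i' j) (iota 0 (nrows T)) == 1).

Definition rk T := count (fun b => superfluous T b.1 b.2) (boxes T).
Definition f_stat T := count id (head [::] T).

Definition restricted T i j := is_zero T i j && one_above T i j.
Definition unrestricted_row T i :=
  ~~ has (fun j => restricted T i j) (iota 0 (row_length T i)).

(* The truncated predecessor is harmless: the first row is unrestricted. *)
Definition u_stat T := (count (unrestricted_row T) (iota 0 (nrows T))).-1.

Definition delete_row i T : filling := take i T ++ drop i.+1 T.

Definition insert_row (r : seq bool) T : filling :=
  let k := count (fun r' => size r <= size r') T in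
  take k T ++ r :: drop k T.

Definition delete_col j T : filling :=
  [seq take j r ++ drop j.+1 r | r <- T].

(* The column c is listed from top to bottom. *)
Definition insert_col (c : seq bool) T : filling :=
  let k := count (fun j => size c <= col_length T j) (iota 0 (ncols T)) in
  mkseq (fun i => let r := nth [::] T i in
                  if i < size c then take k r ++ nth false c i :: drop k r
                  else r)
        (nrows T).

(* The column of length h > 0 whose only 1 is its bottom box. *)
Definition bottom_one_col h : seq bool := rcons (nseq h.-1 false) true.

(* The targets of the moves available from T, one list for each kind of move. *)

Definition enter_targets T : seq filling :=
  if (0 < ncols T) && (col_length T (ncols T).-1 == 1) then
    [:: insert_row (nseq (ncols T).-1 false) (delete_col (ncols T).-1 T)]
  else [::].

Definition hop_right_at T i : seq filling :=
  let l := row_length T i in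
  if is_zero T i l.-1 then
    [:: insert_row (nseq l.-1 false) (delete_row i T)]
  else if superfluous T i l.-1 then
    [:: set_nth [::] T i (take l.-1 (nth [::] T i))]
  else if necessary T i l.-1 then
    (* The deleted column has length i.+1, as its bottom box is in row i. *)
    [:: insert_col (bottom_one_col i) (delete_col l.-1 T)]
  else [::].

Definition hop_right_targets T : seq filling :=
  flatten [seq hop_right_at T i | i <- iota 1 (nrows T).-1
             & row_length T i.+1 < row_length T i].

Definition exit_targets T : seq filling :=
  if (1 < nrows T) && (row_length T (nrows T).-1 == 0) then
    [:: insert_col (bottom_one_col (nrows T).-1) (delete_row (nrows T).-1 T)]
  else [::].

Definition hop_left_targets T : seq filling :=
  [seq set_nth [::] T i.+1 (rcons (nth [::] T i.+1) true)
     | i <- iota 0 (nrows T).-1 & row_length T i.+1 < row_length T i].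

End Fillings.

Section PermutationTableaux.
Variable N : nat.

Record permtab := PermTab {
  permtab_rows :> filling;
  permtabP : is_permutation_tableau permtab_rows
             && (half_perimeter permtab_rows == N.+1) }.

HB.instance Definition _ := [isSub for permtab_rows].
HB.instance Definition _ := [Countable of permtab by <:].

(* Finiteness: there are at most N+1 rows, each with at most N boxes. *)

Lemma permtab_size_rows (T : permtab) : size T <= N.+1.
Proof. by case: T => T /= /andP[_ /eqP <-]; exact: leq_addr. Qed.

Lemma permtab_size_row (T : permtab) (r : seq bool) :
  r \in permtab_rows T -> size r <= N.
Proof.
case: T => -[|r0 T] //= /andP[/and4P[_ srt _ _] /eqP[eqN]].
rewrite inE => /predU1P[->|rT]; first by rewrite -eqN leq_addl.
apply: (@leq_trans (size r0)); last by rewrite -eqN leq_addl.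
have geq_trans : transitive geq.
  by move=> x y z /= xy zx; exact: leq_trans zx xy.
have /allP := order_path_min geq_trans srt.
by apply; apply: map_f.
Qed.

Definition permtab_code (T : permtab) : {bseq N.+1 of {bseq N of bool}} :=
  insub_bseq N.+1 [seq insub_bseq N r | r <- T].

Definition permtab_decode (b : {bseq N.+1 of {bseq N of bool}}) :
  option permtab := insub (map val b).

Lemma permtab_codeK : pcancel permtab_code permtab_decode.
Proof.
move=> T; rewrite /permtab_decode /permtab_code /insub_bseq insubdK; last first.
  by rewrite /in_mem /= size_map permtab_size_rows.
rewrite -map_comp map_id_in ?valK // => r rT /=.
by rewrite insubdK // /in_mem /= (permtab_size_row rT).
Qed.

HB.instance Definition _ : isFinite permtab := PCanIsFinite permtab_codeK.

End PermutationTableaux.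

Local Open Scope ring_scope.

Section FiniteMarkovChains.
Variables (R : realFieldType) (S : finType).
Implicit Types (P : S -> S -> R) (pi : S -> R).

Definition is_stationary P pi :=
  [/\ forall s, 0 <= pi s, \sum_s pi s = 1
    & forall t, \sum_s pi s * P s t = pi t].

(* The steady state is the unique stationary distribution. *)
Definition is_steady_state P pi :=
  is_stationary P pi /\ forall pi', is_stationary P pi' -> pi' =1 pi.

End FiniteMarkovChains.

Section PTChain.
Variables (R : realFieldType) (N : nat) (alpha beta q : R).
Implicit Types S T : permtab N.

(* Every target of a move is again a permutation tableau of the same
   half-perimeter, so no move is lost by letting T range over permtab N. *)
Definition PT_move_prob S T : R :=
  (alpha * (count_mem (T : filling) (enter_targets S))%:R
   + (count_mem (T : filling) (hop_right_targets S))%:R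
   + beta * (count_mem (T : filling) (exit_targets S))%:R
   + q * (count_mem (T : filling) (hop_left_targets S))%:R) / N.+1%:R.

Definition PT_chain S T : R :=
  if T == S then 1 - \sum_(T' : permtab N | T' != S) PT_move_prob S T'
  else PT_move_prob S T.

Definition wt T : R := q ^+ rk T * alpha ^- f_stat T * beta ^- u_stat T.

End PTChain.

(* Main.v *)
Require Import Defs.
From HB Require Import structures.
From mathcomp Require Import all_boot all_order all_algebra.
From mathcomp Require Import zify ring.

Set Implicit Arguments.
Unset Strict Implicit.
Unset Printing Implicit Defensive.

Import Order.TTheory GRing.Theory Num.Theory.

(** The weight is stationary because the flow, weight times rate, splits into
    closed circuits and pairs of opposite flows.

    Leave aside the hops to the left and their reverses, the hops to the right
    that remove a superfluous 1 in a corner.  Every other move takes out a line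
    of the tableau, either a zero row or a column with a single 1 at its
    bottom, and puts back another such line.  Let B, with m rows and n columns,
    be what is left when the line is out; it is a permutation tableau of
    half-perimeter one less.  Write Z_l for B with a zero row of length l put
    in, and C_h for B with a column of length h put in whose only 1 is at the
    bottom.  The moves that have B as their common part form a directed cycle

      C_1 -> Z_n -> Z_(n-1) -> ... -> Z_0 -> C_m -> C_(m-1) -> ... -> C_1

    with rate alpha out of C_1, beta out of Z_0 and 1 elsewhere (entering,
    hopping right with a zero row, exiting, hopping right with a column).
    Putting in a line preserves the weight of B, except that C_1 has one more 1
    in the first row and Z_0 one more unrestricted row, which divides the weight
    by alpha, respectively beta.  So weight times rate is wt B all along the
    cycle, and what flows into a tableau flows out of it
    ([circulation_balanced]).  As for the moves left aside, a hop to the left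
    adds a superfluous 1 and hence a factor q to the weight, which is its rate:
    these moves satisfy detailed balance ([detailed_balance]).

    The effect on the statistics is easy to read off in coordinates, where
    putting in a line shifts the row or column indices by [bump].  Superfluous
    1's become additive data by [rk_ncols]: since each column has exactly one
    topmost 1, the rank is the number of 1's minus the number of columns.

    The steady state is unique because the tableau without columns can be
    reached from every state, by entering and by hopping right at the foot of
    the last column: such moves decrease the function [height].  They have
    positive probability even when q = 0. *)

(** * Uniqueness of stationary distributions *)

Section UniqueStationary.
Local Open Scope ring_scope.
Variables (R : realFieldType) (S : finType) (P : S -> S -> R).
Hypothesis P_ge0 : forall s t, 0 <= P s t.
Hypothesis P_sum1 : forall s, \sum_t P s t = 1.

Definition invariant_measure (d : S -> R) := forall t, \sum_s d s * P s t = d t.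

(** The positive part p of an invariant d satisfies p <= p P pointwise, and
    p and p P have the same total mass because P is stochastic. *)
Lemma invariant_pos_part d :
  invariant_measure d -> invariant_measure (fun s => Num.max (d s) 0).
Proof.
move=> inv_d.
have p_ge0 s : 0 <= Num.max (d s) 0 by rewrite le_max lexx orbT.
have le_p t : Num.max (d t) 0 <= \sum_s Num.max (d s) 0 * P s t.
  rewrite ge_max -{1}inv_d; apply/andP; split.
    by apply: ler_sum => s _; rewrite ler_wpM2r // le_max lexx.
  by apply: sumr_ge0 => s _; rewrite mulr_ge0.
have /eqP: \sum_t (\sum_s Num.max (d s) 0 * P s t - Num.max (d t) 0) = 0.
  rewrite sumrB exchange_big /=; apply/eqP; rewrite subr_eq0; apply/eqP.
  by apply: eq_bigr => s _; rewrite -mulr_sumr P_sum1 mulr1.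
rewrite psumr_eq0 => [/allP eq0 t|t _]; last by rewrite subr_ge0.
by apply/eqP; rewrite -subr_eq0; apply: (implyP (eq0 _ _)).
Qed.

Variables (e : S) (m : S -> nat).
Hypothesis descent : forall s, s != e -> exists2 t, 0 < P s t & (m t < m s)%N.

(** Invariance at t bounds d s * P s t by d t, so the vanishing of d spreads
    from e backwards along transitions of positive probability. *)
Lemma invariant_eq0 d :
  (forall s, 0 <= d s) -> invariant_measure d -> d e = 0 -> forall s, d s = 0.
Proof.
move=> d_ge0 inv_d de0 s.
have [n] := ubnP (m s); elim: n s => // n IHn s lt_ms.
have [-> //|/descent[t Pst lt_mt]] := eqVneq s e.
have dt0 : d t = 0 by apply: IHn; apply: leq_trans lt_mt _.
have /eqP := inv_d t; rewrite dt0 psumr_eq0 => [/allP/(_ s)|i _]; last first.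
  by rewrite mulr_ge0.
by rewrite mem_index_enum mulf_eq0 (gt_eqF Pst) orbF => /(_ isT)/eqP.
Qed.

Lemma invariant_le0 d : invariant_measure d -> d e <= 0 -> forall s, d s <= 0.
Proof.
move=> inv_d de s.
apply/max_idPr; apply: (invariant_eq0 _ (invariant_pos_part inv_d)).
  by move=> t; rewrite le_max lexx orbT.
exact/max_idPr.
Qed.

(** Up to exchanging the two distributions their difference is nonpositive at
    e, hence everywhere by [invariant_le0]; its total mass is 0. *)
Lemma stationary_unique pi pi' :
  is_stationary P pi -> is_stationary P pi' -> pi' =1 pi.
Proof.
move=> [_ pi1 pi_inv] [_ pi1' pi_inv'].
suff le_pi p p' : \sum_s p s = 1 -> invariant_measure p ->
    \sum_s p' s = 1 -> invariant_measure p' -> p e <= p' e -> p' =1 p.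
  have [le_e|/ltW le_e] := leP (pi e) (pi' e); first exact: le_pi.
  by move=> s; rewrite (le_pi pi' pi).
move=> p1 p_inv p1' p_inv' le_e.
have inv_d : invariant_measure (fun s => p s - p' s).
  by move=> t; under eq_bigr do rewrite mulrBl; rewrite sumrB p_inv p_inv'.
have le_p s : p s <= p' s.
  by rewrite -subr_le0; apply: (invariant_le0 inv_d); rewrite subr_le0.
have /eqP: \sum_s (p' s - p s) = 0 by rewrite sumrB p1 p1' subrr.
rewrite psumr_eq0 => [/allP eq0 s|s _]; last by rewrite subr_ge0.
by apply/eqP; rewrite -subr_eq0; apply: (implyP (eq0 _ _)).
Qed.

End UniqueStationary.

(** * Tableaux in coordinates *)

Section Coordinates.
Implicit Types (T : filling) (r : seq bool).
Local Open Scope nat_scope.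

Definition partition_shape T := sorted geq (map size T).

Lemma nth_shape T i : nth 0 (map size T) i = row_length T i.
Proof.
rewrite /row_length; have [lt_i|le_i] := ltnP i (size T); first exact: nth_map.
by rewrite !nth_default ?size_map.
Qed.

Lemma partition_shapeP T :
  reflect (forall i j, i <= j -> row_length T j <= row_length T i)
          (partition_shape T).
Proof.
have geq_trans : transitive geq by move=> x y z /= xy zx; exact: leq_trans xy.
apply: (iffP idP) => [srt i j le_ij|mono].
  rewrite -!nth_shape.
  have [lt_j|le_j] := ltnP j (size (map size T)); last by rewrite nth_default.
  apply: (sorted_leq_nth geq_trans) => //; first exact: (leqnn).
  exact: leq_ltn_trans le_ij lt_j.
by apply/(sortedP 0) => i _; rewrite /= !nth_shape mono.
Qed.

Lemma row_length_default T i : nrows T <= i -> row_length T i = 0.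
Proof. by move=> le_i; rewrite /row_length nth_default. Qed.

Lemma row_length_nrows T i : 0 < row_length T i -> i < nrows T.
Proof.
by apply: contraLR; rewrite -leqNgt -eqn0Ngt => /row_length_default->.
Qed.

Lemma row_length0 T : row_length T 0 = ncols T.
Proof. by case: T. Qed.

(** Row lengths and column lengths are conjugate partitions. *)
Lemma lt_row_length T i j :
  partition_shape T -> (j < row_length T i) = (i < col_length T j).
Proof.
rewrite /row_length /col_length; elim: T i => [|r T IHT] i srt.
  by rewrite nth_nil.
have {}IHT i0 := IHT i0 (path_sorted srt).
have [lt_j|le_j] /= := ltnP j (size r).
  by case: i => [|i] /=; rewrite ?lt_j ?IHT ?add1n.
have : count (fun r' => j < size r') T == 0.
  rewrite -leqn0 leqNgt -IHT -leqNgt.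
  exact: leq_trans (partition_shapeP _ srt 0 1 isT) le_j.
move=> /eqP cnt0; rewrite cnt0.
rewrite [X in _ = (_ < nat_of_bool X + _)]ltnNge le_j.
by case: i => [|i] /=; rewrite ?IHT ?cnt0 // ltnNge le_j.
Qed.

Lemma is_one_size T i j : is_one T i j -> j < row_length T i.
Proof.
by apply: contraLR; rewrite -leqNgt => le_j; rewrite /is_one nth_default.
Qed.

Lemma is_one_nrows T i j : is_one T i j -> i < nrows T.
Proof. by move/is_one_size/(leq_ltn_trans (leq0n _))/row_length_nrows. Qed.

Lemma iota0P (p : pred nat) n :
  reflect (exists2 i, i < n & p i) (has p (iota 0 n)).
Proof.
by apply: (iffP hasP) => -[i]; rewrite ?mem_iota => lt_i p_i; exists i;
  rewrite ?mem_iota.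
Qed.

Lemma one_aboveP T i j :
  reflect (exists2 i', i' < i & is_one T i' j) (one_above T i j).
Proof. exact: iota0P. Qed.

Lemma mem_boxes T i j : ((i, j) \in boxes T) = (j < row_length T i).
Proof.
apply/allpairsPdep/idP => [[i' [j' [_]]]|lt_j].
  by rewrite mem_iota => lt_j' [-> ->].
by exists i, j; rewrite !mem_iota /= (row_length_nrows (leq_ltn_trans _ lt_j)).
Qed.

(** The conditions on the entries, in coordinates.  The existence of a 1 needs
    no bound on its row, as [is_one] is false outside the diagram. *)
Definition tableau_rules T :=
  [/\ 0 < nrows T, forall j, j < ncols T -> exists i, is_one T i j
    & forall i j i' j', i' < i -> j' < j -> j < row_length T i ->
        is_one T i' j -> is_one T i j' -> is_one T i j].

Lemma permutation_tableauP T :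
  reflect (partition_shape T /\ tableau_rules T) (is_permutation_tableau T).
Proof.
apply: (iffP and4P) => [[T0 srt cols rule]|[srt [T0 cols rule]]].
  split=> //; split=> // [j lt_j|i j i' j' lt_i lt_j j_row one' one_left].
    have /allP/(_ j) := cols; rewrite mem_iota => /(_ lt_j)/iota0P[i _ ij].
    by exists i.
  have /allP/(_ (i, j)) := rule; rewrite mem_boxes => /(_ j_row).
  rewrite /is_zero j_row /=; case: (is_one T i j) => //= /negP[]; apply/andP.
  by split; apply/iota0P; [exists i' | exists j'].
split=> //.
  apply/allP=> j; rewrite mem_iota => /cols[i ij]; apply/iota0P; exists i => //.
  exact: is_one_nrows ij.
apply/allP=> -[i j]; rewrite mem_boxes /= => j_row; apply/negP.
case/and3P=> /andP[_ /negP not1]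
  /iota0P[i' lt_i one'] /iota0P[j' lt_j one_left].
exact/not1/(rule _ _ _ _ lt_i lt_j).
Qed.

Lemma unrestricted_rowP T i :
  reflect (forall i' j, i' < i -> j < row_length T i ->
             is_one T i' j -> is_one T i j)
          (unrestricted_row T i).
Proof.
apply: (iffP negP) => [no_restr i' j lt_i j_row one'|all_one].
  apply/negPn/negP=> not1; case: no_restr; apply/iota0P; exists j => //.
  by rewrite /restricted /is_zero j_row not1; apply/one_aboveP; exists i'.
case/iota0P=> j j_row /andP[/andP[_ /negP not1]] /one_aboveP[i' lt_i one'].
exact/not1/(all_one i').
Qed.

Lemma unrestricted_row0 T : unrestricted_row T 0.
Proof. exact/unrestricted_rowP. Qed.

Lemma u_statE T : 0 < nrows T ->
  (u_stat T).+1 = count (unrestricted_row T) (iota 0 (nrows T)).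
Proof.
move=> T0; rewrite prednK // -has_count; apply/iota0P; exists 0 => //.
exact: unrestricted_row0.
Qed.

Definition ones T := sumn (map (count id) T).

Lemma sum_iota_widen m n (F : nat -> nat) :
  m <= n -> (forall j, m <= j -> F j = 0) ->
  \sum_(j <- iota 0 m) F j = \sum_(j <- iota 0 n) F j.
Proof.
move=> le_mn F0; rewrite -[in RHS](subnKC le_mn) iotaD big_cat /=.
by rewrite [X in _ + X]big_seq [X in _ + X]big1 ?addn0 // => j;
  rewrite mem_iota add0n => /andP[/F0].
Qed.

(** At most one index is the first one to satisfy p.  For a column this counts
    its topmost 1. *)
Lemma sum_first_iota (p : pred nat) n :
  \sum_(i <- iota 0 n) (p i && ~~ has p (iota 0 i) : nat) = has p (iota 0 n).
Proof.
elim: n => [|n IHn]; first by rewrite big_nil.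
rewrite -addn1 iotaD big_cat IHn has_cat /= big_seq1 orbF /=.
by case: has; case: (p n).
Qed.

Lemma onesE T :
  ones T = \sum_(i <- iota 0 (nrows T)) \sum_(j <- iota 0 (row_length T i))
             (is_one T i j : nat).
Proof.
rewrite /ones sumnE big_map.
rewrite (big_nth [::]) /index_iota subn0; apply: eq_bigr => i _.
rewrite -sum1_count big_mkcond (big_nth false) /index_iota subn0.
by apply: eq_bigr => j _; rewrite /is_one; case: nth.
Qed.

(** Every 1 is either topmost or superfluous, and each column has exactly one
    topmost 1. *)
Lemma rk_ncols T : is_permutation_tableau T -> rk T + ncols T = ones T.
Proof.
case/permutation_tableauP=> srt [_ cols _].
have widen (P : nat -> nat -> bool) i : (forall j, P i j -> is_one T i j) ->
  \sum_(j <- iota 0 (row_length T i)) (P i j : nat)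
   = \sum_(j <- iota 0 (ncols T)) (P i j : nat).
  move=> P1; apply: sum_iota_widen => [|j le_j].
    by rewrite -row_length0; apply: (partition_shapeP _ srt).
  by case: (boolP (P i j)) => // /P1/is_one_size; rewrite ltnNge le_j.
have rkE : rk T =
    \sum_(i <- iota 0 (nrows T)) \sum_(j <- iota 0 (ncols T))
      (superfluous T i j : nat).
  rewrite /rk -sum1_count big_mkcond big_allpairs_dep /=.
  apply: eq_bigr => i _; rewrite -widen => [|j /andP[]//].
  by apply: eq_bigr => j _; case: superfluous.
have ncolsE : ncols T =
    \sum_(i <- iota 0 (nrows T)) \sum_(j <- iota 0 (ncols T))
      (topmost T i j : nat).
  rewrite exchange_big /= -[LHS](size_iota 0) -sum1_size big_seq [RHS]big_seq.
  apply: eq_bigr => j; rewrite mem_iota => /cols[i ij].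
  rewrite (sum_first_iota (fun i => is_one T i j)); symmetry; apply/eqP.
  by rewrite eqb1; apply/iota0P; exists i => //; exact: is_one_nrows ij.
rewrite [X in _ + X]ncolsE rkE onesE -big_split; apply: eq_bigr => i _ /=.
rewrite -big_split widen //; apply: eq_bigr => j _ /=.
by rewrite /superfluous /topmost; case: is_one; case: one_above.
Qed.

End Coordinates.

(** * Inserting a zero row *)

Lemma bump_cases k i : i = k \/ exists i', i = bump k i'.
Proof.
have [->|nk] := eqVneq i k; [by left | right; exists (unbump k i)].
by rewrite unbumpKcond (negPf nk).
Qed.

Lemma ltn_bump2 k i j : (bump k i < bump k j) = (i < j).
Proof. by rewrite !ltnNge leq_bump2. Qed.

Section ZeroRows.
Implicit Types (T B : filling) (r : seq bool).
Local Open Scope nat_scope.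

(** The index that [insert_row] gives to a row of length l. *)
Definition row_slot l T := count (fun r => l <= size r) T.

Lemma row_slot_le l T : row_slot l T <= nrows T.
Proof. exact: count_size. Qed.

Lemma lt_row_slot l T i :
  partition_shape T -> i < nrows T -> (i < row_slot l T) = (l <= row_length T i).
Proof.
case: l => [|l] srt lt_i; last by rewrite (lt_row_length _ _ srt).
by rewrite /row_slot (@eq_count _ _ xpredT) // count_predT lt_i.
Qed.

Definition add_zero_row l T := insert_row (nseq l false) T.

Lemma nth_insert_row r T i :
  let k := row_slot (size r) T in
  nth [::] (insert_row r T) (bump k i) = nth [::] T i
  /\ nth [::] (insert_row r T) k = r.
Proof.
move=> k; rewrite /insert_row -/k.
have sz : size (take k T) = k by rewrite size_takel ?row_slot_le.
split; rewrite nth_cat sz ?ltnn ?subnn // /bump.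
have [le_k|lt_i] := leqP k i; last by rewrite add0n lt_i nth_take.
by rewrite add1n ltnNge leqW // subSn //= nth_drop subnKC.
Qed.

Lemma size_insert_row r T : nrows (insert_row r T) = (nrows T).+1.
Proof.
by rewrite /nrows /insert_row size_cat /= addnS -size_cat cat_take_drop.
Qed.

Lemma insert_rowK r T : delete_row (row_slot (size r) T) (insert_row r T) = T.
Proof.
rewrite /insert_row /delete_row; set k := count _ _.
have sz : size (take k T) = k by rewrite size_takel ?row_slot_le.
rewrite take_cat drop_cat sz ltnn subnn take0 cats0.
by rewrite ltnNge leqnSn /= subSnn /= drop0 cat_take_drop.
Qed.

Lemma delete_row_shape i T :
  partition_shape T -> partition_shape (delete_row i T).
Proof.
apply: subseq_sorted => [x y z /= xy zx|]; first exact: leq_trans xy.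
apply: map_subseq; rewrite -{2}(cat_take_drop i T) cat_subseq //.
by rewrite -addn1 addnC -drop_drop drop_subseq.
Qed.

(** The lowest row of its length goes back to its place when it is deleted and
    inserted again; below it there are only shorter rows or none. *)
Lemma row_slot_delete_row T i : partition_shape T -> i < nrows T ->
  (row_length T i.+1 < row_length T i) || (i.+1 == nrows T) ->
  row_slot (row_length T i) (delete_row i T) = i.
Proof.
move=> srt lt_i last_i; set l := row_length T i.
have slot : row_slot l T = i.+1.
  apply/eqP; rewrite eqn_leq lt_row_slot // leqnn andbT.
  case/orP: last_i => [lt_r|/eqP->]; last exact: row_slot_le.
  have [le_n|lt_n] := leqP (nrows T) i.+1.
    exact: leq_trans (row_slot_le _ _) le_n.
  by rewrite leqNgt lt_row_slot // -ltnNge.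
move: slot; rewrite /row_slot -[in X in X -> _](cat_take_drop i T).
rewrite (drop_nth [::] lt_i) /delete_row !count_cat /=.
by rewrite -/(row_length T i) leqnn add1n addnS => -[].
Qed.

Lemma delete_rowK T i : partition_shape T -> i < nrows T ->
  (row_length T i.+1 < row_length T i) || (i.+1 == nrows T) ->
  insert_row (nth [::] T i) (delete_row i T) = T.
Proof.
move=> srt lt_i last_i; rewrite /insert_row -/(row_length T i).
rewrite -/(row_slot _ _) row_slot_delete_row // /delete_row.
have sz : size (take i T) = i by rewrite size_takel // ltnW.
rewrite take_cat drop_cat sz ltnn subnn take0 cats0 drop0.
by rewrite -drop_nth // cat_take_drop.
Qed.

Section Insertion.
Variables (l : nat) (B : filling).
Hypotheses (srtB : partition_shape B) (B0 : 0 < nrows B) (le_l : l <= ncols B).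
Let k := row_slot l B.
Let Z := add_zero_row l B.

Lemma add_zero_row_slot : 0 < k.
Proof. by rewrite lt_row_slot // row_length0. Qed.

Lemma nth_add_zero_row i :
  nth [::] Z (bump k i) = nth [::] B i /\ nth [::] Z k = nseq l false.
Proof. by have := nth_insert_row (nseq l false) B i; rewrite size_nseq. Qed.

Lemma row_length_add_zero_row i : row_length Z (bump k i) = row_length B i.
Proof. by rewrite /row_length; case: (nth_add_zero_row i) => ->. Qed.

Lemma row_length_new_zero_row : row_length Z k = l.
Proof.
by rewrite /row_length; case: (nth_add_zero_row 0) => _ ->; rewrite size_nseq.
Qed.

Lemma is_one_add_zero_row i j : is_one Z (bump k i) j = is_one B i j.
Proof. by rewrite /is_one; case: (nth_add_zero_row i) => ->. Qed.

Lemma is_one_new_zero_row j : is_one Z k j = false.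
Proof.
by rewrite /is_one; case: (nth_add_zero_row 0) => _ ->; rewrite nth_nseq if_same.
Qed.

Lemma ncols_add_zero_row : ncols Z = ncols B.
Proof.
rewrite -!row_length0 -(row_length_add_zero_row 0).
by rewrite /bump leqNgt add_zero_row_slot.
Qed.

Lemma nrows_add_zero_row : nrows Z = (nrows B).+1.
Proof. exact: size_insert_row. Qed.

(** The new row comes below exactly the rows of length at least l. *)
Lemma add_zero_row_shape : partition_shape Z.
Proof.
apply/partition_shapeP => i j.
have [->|[i' ->]] := bump_cases k i; have [->|[j' ->]] := bump_cases k j => //.
- rewrite row_length_new_zero_row row_length_add_zero_row => le_j.
  have {}le_j : k <= j' by move: le_j; rewrite /bump; case: leqP => //; lia.
  have [/row_length_default->//|lt_j] := leqP (nrows B) j'.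
  by apply: ltnW; rewrite ltnNge -lt_row_slot // -leqNgt.
- rewrite row_length_new_zero_row row_length_add_zero_row => le_i.
  have {}le_i : i' < k by move: le_i; rewrite /bump; case: leqP => //; lia.
  by rewrite -lt_row_slot // (leq_trans le_i) ?row_slot_le.
by rewrite leq_bump2 !row_length_add_zero_row => /(partition_shapeP _ srtB).
Qed.

(** A zero row has no 1 to satisfy or to break a condition; in particular none
    of its 0's has a 1 to its left. *)
Lemma add_zero_row_tableau :
  is_permutation_tableau Z = is_permutation_tableau B.
Proof.
apply/permutation_tableauP/permutation_tableauP=> -[_ [_ cols rule]].
  split=> //; split=> // [j|i j i' j' lt_i lt_j j_row one' one_left].
    rewrite -ncols_add_zero_row => /cols[i].
    have [->|[i' ->]] := bump_cases k i; first by rewrite is_one_new_zero_row.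
    by rewrite is_one_add_zero_row; exists i'.
  rewrite -is_one_add_zero_row; apply: (rule _ _ (bump k i') j') => //;
    by rewrite ?ltn_bump2 ?row_length_add_zero_row ?is_one_add_zero_row.
split; first exact: add_zero_row_shape.
split=> [|j|i j i' j']; first by rewrite nrows_add_zero_row.
  rewrite ncols_add_zero_row => /cols[i ij]; exists (bump k i).
  by rewrite is_one_add_zero_row.
have [->|[a ->]] := bump_cases k i; first by rewrite !is_one_new_zero_row.
have [->|[b ->]] := bump_cases k i'; first by rewrite !is_one_new_zero_row.
rewrite ltn_bump2 row_length_add_zero_row !is_one_add_zero_row; exact: rule.
Qed.

Lemma ones_add_zero_row : ones Z = ones B.
Proof.
rewrite /ones /Z /add_zero_row /insert_row map_cat sumn_cat /= count_nseq mul0n.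
by rewrite add0n -sumn_cat -map_cat cat_take_drop.
Qed.

Lemma f_stat_add_zero_row : f_stat Z = f_stat B.
Proof.
rewrite /f_stat -!nth0; case: (nth_add_zero_row 0) => <- _.
by rewrite /bump leqNgt add_zero_row_slot.
Qed.

Lemma area_add_zero_row :
  sumn (map size Z) = l + sumn (map size B).
Proof.
rewrite /Z /add_zero_row /insert_row map_cat sumn_cat /= size_nseq addnCA.
by rewrite -sumn_cat -map_cat cat_take_drop.
Qed.

Hypothesis tabB : is_permutation_tableau B.

Lemma rk_add_zero_row : rk Z = rk B.
Proof.
apply/eqP; rewrite -(eqn_add2r (ncols B)) rk_ncols // -{1}ncols_add_zero_row.
by rewrite rk_ncols ?ones_add_zero_row // add_zero_row_tableau.
Qed.

Lemma unrestricted_add_zero_row i :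
  unrestricted_row Z (bump k i) = unrestricted_row B i.
Proof.
apply/unrestricted_rowP/unrestricted_rowP => unr i' j lt_i.
  rewrite -row_length_add_zero_row -!is_one_add_zero_row; apply: unr.
  by rewrite ltn_bump2.
move: lt_i; have [->|[a ->]] := bump_cases k i'.
  by rewrite !is_one_new_zero_row.
rewrite ltn_bump2 row_length_add_zero_row !is_one_add_zero_row; exact: unr.
Qed.

(** Only the rows above the new row reach its last column, so the 1 that this
    column contains restricts the last 0 of the new row. *)
Lemma unrestricted_new_zero_row : unrestricted_row Z k = (l == 0).
Proof.
apply/unrestricted_rowP/eqP => [unr|l0 i j _]; last first.
  by rewrite row_length_new_zero_row l0.
apply/eqP; rewrite -leqn0 leqNgt; apply/negP=> l_gt0.
have [_ [_ /(_ l.-1) cols _]] := permutation_tableauP _ tabB.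
have [|i i_one] := cols; first by rewrite prednK.
have lt_k : i < k.
  by rewrite lt_row_slot ?(is_one_nrows i_one) // -(prednK l_gt0) is_one_size.
have := unr i l.-1 lt_k; rewrite row_length_new_zero_row prednK // leqnn.
have -> : i = bump k i by rewrite /bump leqNgt lt_k.
by rewrite is_one_add_zero_row i_one is_one_new_zero_row => /(_ isT isT).
Qed.

Lemma u_stat_add_zero_row : u_stat Z = (l == 0) + u_stat B.
Proof.
apply: succn_inj; rewrite -addnS !u_statE // nrows_add_zero_row //.
have perm_k :
    perm_eq (iota 0 (nrows B).+1) (k :: map (bump k) (iota 0 (nrows B))).
  have k_notin : k \notin map (bump k) (iota 0 (nrows B)).
    by apply/mapP=> -[i _ /eqP]; rewrite (negPf (neq_bump _ _)).
  have uniq_k : uniq (k :: map (bump k) (iota 0 (nrows B))).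
    by rewrite /= k_notin map_inj_uniq ?iota_uniq //; exact: can_inj (bumpK k).
  rewrite perm_sym; apply: uniq_perm (iota_uniq _ _) _ => //.
  apply: (uniq_min_size uniq_k _ _).2; last first.
    by rewrite /= size_map !size_iota.
  move=> i; rewrite inE mem_iota => /predU1P[->|/mapP[j]].
    by rewrite add0n ltnS row_slot_le.
  rewrite mem_iota /bump => lt_j ->; lia.
rewrite (permP perm_k) /= unrestricted_new_zero_row count_map.
by congr (_ + _); apply: eq_count => i; exact: unrestricted_add_zero_row.
Qed.

End Insertion.
End ZeroRows.

(** * Inserting a column with a single 1 at its bottom *)

Section BottomOneColumns.
Implicit Types (T B : filling) (r : seq bool).
Local Open Scope nat_scope.

Definition add_column h T := insert_col (bottom_one_col h) T.

Lemma sum_rows (g : seq bool -> nat) T :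
  sumn (map g T) = \sum_(i <- iota 0 (nrows T)) g (nth [::] T i).
Proof. by rewrite sumnE big_map (big_nth [::]) /index_iota subn0. Qed.

Lemma sum_iota_indicator (p : pred nat) n :
  \sum_(i <- iota 0 n) (p i : nat) = count p (iota 0 n).
Proof.
by rewrite -sum1_count [RHS]big_mkcond; apply: eq_bigr => i _; case: (p i).
Qed.

Lemma count_ltn_iota m n : m <= n -> count (fun i => i < m) (iota 0 n) = m.
Proof. by move=> le_mn; rewrite -size_filter (@filter_iota_ltn 0) ?size_iota. Qed.

Lemma nth_delete_col k T i :
  nth [::] (delete_col k T) i
  = take k (nth [::] T i) ++ drop k.+1 (nth [::] T i).
Proof.
have [lt_i|le_i] := ltnP i (size T); first by rewrite (nth_map [::]).
by rewrite !nth_default ?size_map.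
Qed.

Lemma nrows_delete_col k T : nrows (delete_col k T) = nrows T.
Proof. exact: size_map. Qed.

Lemma row_length_delete_col k T i :
  row_length (delete_col k T) i = row_length T i - (k < row_length T i).
Proof.
by rewrite /row_length nth_delete_col size_cat size_drop size_take; case: ltnP; lia.
Qed.

Lemma delete_col_shape k T :
  partition_shape T -> partition_shape (delete_col k T).
Proof.
move=> /partition_shapeP mono; apply/partition_shapeP => i j /mono.
by rewrite !row_length_delete_col; lia.
Qed.

Section Insertion.
Variables (h : nat) (B : filling).
Hypotheses (srtB : partition_shape B) (h0 : 0 < h) (le_h : h <= nrows B).
Let k := row_length B h.-1.
Let C := add_column h B.

(** The columns of length at least h are those that meet row h.-1, so the new
    column is the last box of that row: its index is the length of the row. *)
Lemma nth_add_column i :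
  nth [::] C i = if i < h
    then take k (nth [::] B i) ++ (i == h.-1) :: drop k (nth [::] B i)
    else nth [::] B i.
Proof.
have sz : size (bottom_one_col h) = h by rewrite size_rcons size_nseq prednK.
have slot : count (fun j => h <= col_length B j) (iota 0 (ncols B)) = k.
  rewrite (@eq_count _ _ (fun j => j < k)); last first.
    by move=> j; rewrite /= -{1}(prednK h0) -lt_row_length.
  rewrite count_ltn_iota // -row_length0.
  exact: (partition_shapeP _ srtB).
rewrite /C /add_column /insert_col sz slot.
have [lt_i|le_i] := ltnP i (nrows B); last first.
  rewrite !nth_default ?size_mkseq //.
  by rewrite (leq_gtF (leq_trans le_h le_i)).
rewrite nth_mkseq //; case: ifP => // lt_ih.
rewrite /bottom_one_col nth_rcons size_nseq nth_nseq if_same.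
by case: ltngtP => //; rewrite ltnNge -ltnS prednK ?lt_ih.
Qed.

Lemma nrows_add_column : nrows C = nrows B.
Proof. exact: size_mkseq. Qed.

Lemma row_length_add_column i : row_length C i = (i < h) + row_length B i.
Proof.
rewrite /row_length nth_add_column; case: ifP => // _.
by rewrite size_cat /= addnS -size_cat cat_take_drop.
Qed.

Lemma ncols_add_column : ncols C = (ncols B).+1.
Proof. by rewrite -!row_length0 row_length_add_column h0. Qed.

Lemma le_slot_add_column i : i < h -> k <= row_length B i.
Proof. by move=> lt_i; apply: (partition_shapeP _ srtB); rewrite -ltnS prednK. Qed.

Lemma slot_le_add_column i : h <= i -> row_length B i <= k.
Proof.
move=> le_i; apply: (partition_shapeP _ srtB).
exact: leq_trans (leq_pred h) le_i.
Qed.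

Lemma is_one_add_column i j : is_one C i (bump k j) = is_one B i j.
Proof.
rewrite /is_one nth_add_column; case: (ltnP i h) => [lt_i|le_i].
  have sz := size_takel (le_slot_add_column lt_i).
  rewrite nth_cat sz /bump; have [le_j|lt_j] := leqP k j.
    by rewrite add1n ltnNge leqW // subSn //= nth_drop subnKC.
  by rewrite add0n lt_j nth_take.
rewrite /bump; have [le_j|//] := leqP k j.
have sz := leq_trans (slot_le_add_column le_i) le_j.
by rewrite add1n (nth_default _ sz) (nth_default _ (leqW sz)).
Qed.

Lemma is_one_new_column i : is_one C i k = (i == h.-1).
Proof.
rewrite /is_one nth_add_column; case: (ltnP i h) => [lt_i|le_i].
  by rewrite nth_cat (size_takel (le_slot_add_column lt_i)) ltnn subnn.
rewrite nth_default ?slot_le_add_column //.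
by rewrite gtn_eqF // prednK.
Qed.

Lemma lt_row_length_add_column i j :
  (bump k j < row_length C i) = (j < row_length B i).
Proof.
rewrite row_length_add_column; case: (ltnP i h) => [|] /=.
  by move=> /le_slot_add_column; rewrite /bump; lia.
by move=> /slot_le_add_column; rewrite /bump; lia.
Qed.

(** The 1 of the new column is its bottom box, hence has no box below it. *)
Lemma new_column_below i i' : i' < i -> is_one C i' k -> row_length C i <= k.
Proof.
move=> lt_i; rewrite is_one_new_column => /eqP def_i'.
have le_i : h <= i by rewrite -(prednK h0) -def_i'.
by rewrite row_length_add_column ltnNge le_i slot_le_add_column.
Qed.

Lemma add_column_shape : partition_shape C.
Proof.
apply/partition_shapeP => i j le_ij.
have := partition_shapeP _ srtB _ _ le_ij.
by rewrite !row_length_add_column; lia.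
Qed.

(** A 0 of the new column has no 1 above it, and the 1 of the new column has
    no box below it and none to its right: the new column takes no part in a
    violation of the rule on 0's. *)
Lemma add_column_tableau : is_permutation_tableau C = is_permutation_tableau B.
Proof.
apply/permutation_tableauP/permutation_tableauP=> -[_ [C0 cols rule]].
  split=> //; split=> [|j lt_j|i j i' j' lt_i lt_j j_row one' one_left].
  - by rewrite -nrows_add_column.
  - have [|i] := cols (bump k j).
      by rewrite -row_length0 lt_row_length_add_column row_length0.
    by rewrite is_one_add_column; exists i.
  rewrite -is_one_add_column; apply: (rule _ _ i' (bump k j')) => //;
    by rewrite ?ltn_bump2 ?lt_row_length_add_column ?is_one_add_column.
split; first exact: add_column_shape.
split=> [|j|i j i' j']; first by rewrite nrows_add_column.
  have [->|[a ->]] := bump_cases k j.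
    by exists h.-1; rewrite is_one_new_column.
  rewrite -row_length0 lt_row_length_add_column row_length0 => /cols[i ij].
  by exists i; rewrite is_one_add_column.
move=> lt_i; have [->|[a ->]] := bump_cases k j.
  by move=> _ lt_k /(new_column_below lt_i); rewrite leqNgt lt_k.
rewrite lt_row_length_add_column; have [->|[b ->]] := bump_cases k j'.
  rewrite is_one_new_column /bump => lt_a a_row _ /eqP def_i.
  by move: a_row lt_a; rewrite def_i -/k; lia.
rewrite ltn_bump2 !is_one_add_column; exact: rule.
Qed.

Lemma ones_row_add_column i :
  count id (nth [::] C i) = (i == h.-1) + count id (nth [::] B i).
Proof.
rewrite nth_add_column; case: ltnP => [_|le_i].
  by rewrite count_cat /= addnCA -count_cat cat_take_drop.
by rewrite gtn_eqF // prednK.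
Qed.

Lemma ones_add_column : ones C = (ones B).+1.
Proof.
rewrite /ones !sum_rows nrows_add_column.
under eq_bigr do rewrite ones_row_add_column.
rewrite big_split /= sum_iota_indicator -add1n; congr (_ + _).
by rewrite count_uniq_mem ?iota_uniq // mem_iota add0n prednK ?le_h.
Qed.

Lemma area_add_column : sumn (map size C) = h + sumn (map size B).
Proof.
rewrite !sum_rows nrows_add_column.
under eq_bigr do rewrite -/(row_length _ _) row_length_add_column.
rewrite big_split /= sum_iota_indicator; congr (_ + _).
exact: count_ltn_iota.
Qed.

Lemma f_stat_add_column : f_stat C = (h == 1) + f_stat B.
Proof.
by rewrite /f_stat -!nth0 ones_row_add_column eq_sym -(eqn_add2r 1) !addn1 prednK.
Qed.

Lemma unrestricted_add_column i : unrestricted_row C i = unrestricted_row B i.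
Proof.
apply/unrestricted_rowP/unrestricted_rowP => unr i' j lt_i.
  by rewrite -lt_row_length_add_column -!is_one_add_column; apply: unr.
have [->|[a ->]] := bump_cases k j.
  by move=> lt_k /(new_column_below lt_i); rewrite leqNgt lt_k.
rewrite lt_row_length_add_column !is_one_add_column; exact: unr.
Qed.

Lemma u_stat_add_column : u_stat C = u_stat B.
Proof.
rewrite /u_stat nrows_add_column; congr _.-1.
by apply: eq_count => i; exact: unrestricted_add_column.
Qed.

(** One more 1 and one more column. *)
Lemma rk_add_column : is_permutation_tableau B -> rk C = rk B.
Proof.
move=> tabB; apply/eqP; rewrite -(eqn_add2r (ncols C)) rk_ncols; last first.
  by rewrite add_column_tableau.
by rewrite ones_add_column ncols_add_column addnS rk_ncols.
Qed.

Lemma add_columnK : delete_col k C = B.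
Proof.
apply: (@eq_from_nth _ [::]) => [|i _]; first by rewrite size_map size_mkseq.
rewrite nth_delete_col nth_add_column; case: (ltnP i h) => [lt_i|le_i].
  have sz := size_takel (le_slot_add_column lt_i).
  rewrite take_cat drop_cat sz ltnn subnn take0 cats0 ltnNge leqnSn /=.
  by rewrite subSnn /= drop0 cat_take_drop.
have le_k := slot_le_add_column le_i.
by rewrite take_oversize // drop_oversize ?cats0 // leqW.
Qed.

End Insertion.

(** The inverse of [add_columnK]: a column that ends in a corner and has a
    single 1, in that corner, is of the form that [add_column] inserts. *)
Lemma delete_colK T i k :
  partition_shape T -> row_length T i = k.+1 -> row_length T i.+1 <= k ->
  (forall i', is_one T i' k = (i' == i)) ->
  add_column i.+1 (delete_col k T) = T.
Proof.
move=> srt len_i len_i1 col_k.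
have lt_i : i < nrows T by apply: row_length_nrows; rewrite len_i.
have slot : row_length (delete_col k T) i.+1.-1 = k.
  by rewrite row_length_delete_col len_i ltnSn subn1.
apply: (@eq_from_nth _ [::]) => [|i' _]; first by rewrite size_mkseq nrows_delete_col.
rewrite nth_add_column ?delete_col_shape ?nrows_delete_col // slot.
rewrite nth_delete_col; set r := nth [::] T i'.
case: ltnP => [le_i|lt_i'].
  have lt_k : k < size r.
    by rewrite -len_i; apply: (partition_shapeP _ srt); rewrite -ltnS.
  have sz : size (take k r) = k by rewrite size_takel // ltnW.
  rewrite take_cat drop_cat sz ltnn subnn take0 cats0 drop0 -col_k.
  by rewrite /is_one -/r -drop_nth // cat_take_drop.
have le_k : size r <= k.
  by apply: leq_trans len_i1; apply: (partition_shapeP _ srt).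
by rewrite take_oversize // drop_oversize ?cats0 // leqW.
Qed.

End BottomOneColumns.

(** * Adding and removing a box *)

Section Boxes.
Implicit Types (T : filling).
Local Open Scope nat_scope.

Definition add_box i T := set_nth [::] T i (rcons (nth [::] T i) true).

Definition remove_box i T :=
  set_nth [::] T i (take (row_length T i).-1 (nth [::] T i)).

Definition corner T i := row_length T i.+1 < row_length T i.

Lemma row_length_remove_box i T a :
  row_length (remove_box i T) a = row_length T a - (a == i).
Proof.
rewrite /row_length nth_set_nth /=; case: eqP => [->|_]; last by rewrite subn0.
by rewrite size_takel ?leq_pred // subn1.
Qed.

Lemma nrows_set_row i r T : i < nrows T -> nrows (set_nth [::] T i r) = nrows T.
Proof. by move=> lt_i; rewrite /nrows size_set_nth; apply/maxn_idPr. Qed.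

Lemma add_boxK i T : i < nrows T -> remove_box i (add_box i T) = T.
Proof.
move=> lt_i; apply: (@eq_from_nth _ [::]) => [|a _].
  by rewrite !size_set_nth !(maxn_idPr _) // size_set_nth; apply/maxn_idPr.
rewrite nth_set_nth /=; case: eqP => [->|/eqP ne_a]; last first.
  by rewrite nth_set_nth /= (negPf ne_a).
by rewrite /row_length nth_set_nth /= eqxx size_rcons /= -cats1 take_size_cat.
Qed.

Lemma remove_boxK i T :
  is_one T i (row_length T i).-1 -> add_box i (remove_box i T) = T.
Proof.
move=> one_i; have lt_i := is_one_nrows one_i.
apply: (@eq_from_nth _ [::]) => [|a _].
  by rewrite !size_set_nth !(maxn_idPr _) // size_set_nth; apply/maxn_idPr.
rewrite nth_set_nth /=; case: eqP => [->|/eqP ne_a]; last first.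
  by rewrite nth_set_nth /= (negPf ne_a).
have sz := ltn_predK (is_one_size one_i).
rewrite nth_set_nth /= eqxx; move: one_i; rewrite /is_one => one_i.
rewrite -[RHS]take_size -/(row_length T i) -[in RHS]sz.
by rewrite (take_nth false) ?one_i // -/(row_length T i) sz.
Qed.

Section Adding.
Variables (T : filling) (i : nat).
Hypotheses (srt : partition_shape T) (lt_i : i < nrows T).
Hypotheses (i_gt0 : 0 < i) (short_i : row_length T i < row_length T i.-1).
Let l := row_length T i.
Let U := add_box i T.

Lemma row_length_add_box a : row_length U a = (a == i) + row_length T a.
Proof.
rewrite /row_length nth_set_nth /=; case: eqP => [->|//].
by rewrite size_rcons.
Qed.

Lemma is_one_add_box a b : is_one U a b = (a == i) && (b == l) || is_one T a b.
Proof.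
rewrite /is_one nth_set_nth /=; case: eqP => [->|//].
rewrite nth_rcons -/(row_length T i) -/l.
by case: ltngtP => //= lt_l; rewrite nth_default // ltnW.
Qed.

Lemma ncols_add_box : ncols U = ncols T.
Proof. by rewrite -!row_length0 row_length_add_box eq_sym gtn_eqF. Qed.

Lemma nrows_add_box : nrows U = nrows T.
Proof. exact: nrows_set_row. Qed.

Lemma corner_add_box : corner U i.
Proof.
rewrite /corner !row_length_add_box eqxx gtn_eqF // ltnS.
exact: (partition_shapeP _ srt).
Qed.

Lemma below_add_box a : i < a -> row_length U a <= l.
Proof.
move=> lt_a; rewrite row_length_add_box gtn_eqF //.
by apply: (partition_shapeP _ srt); exact: ltnW.
Qed.

(** The column of the new box already contains a 1, which can only be above. *)
Lemma superfluous_add_box :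
  is_permutation_tableau T -> superfluous U i (row_length U i).-1.
Proof.
case/permutation_tableauP=> _ [_ cols _].
rewrite row_length_add_box eqxx /= -/l.
have [|a one_a] := cols l.
  rewrite -row_length0; apply: leq_trans short_i _.
  exact: (partition_shapeP _ srt).
have lt_a : a < i.
  rewrite ltnNge; apply/negP=> /(partition_shapeP _ srt).
  by rewrite leqNgt (is_one_size one_a).
have one_i : is_one U i l by rewrite is_one_add_box !eqxx.
rewrite /superfluous /topmost one_i negbK /=; apply/one_aboveP; exists a => //.
by rewrite is_one_add_box one_a orbT.
Qed.

Lemma ones_add_box : ones U = (ones T).+1.
Proof.
rewrite /ones !sum_rows nrows_add_box.
under eq_bigr => a _.
  have -> : count id (nth [::] U a) = (a == i) + count id (nth [::] T a).
    rewrite nth_set_nth /=; case: eqP => [->|//].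
    by rewrite -cats1 count_cat addnC.
  over.
rewrite big_split /= sum_iota_indicator -add1n; congr (_ + _).
by rewrite count_uniq_mem ?iota_uniq // mem_iota add0n lt_i.
Qed.

Lemma area_add_box : sumn (map size U) = (sumn (map size T)).+1.
Proof.
rewrite !sum_rows nrows_add_box.
under eq_bigr do rewrite -/(row_length _ _) row_length_add_box.
rewrite big_split /= sum_iota_indicator -add1n; congr (_ + _).
by rewrite count_uniq_mem ?iota_uniq // mem_iota add0n lt_i.
Qed.

Lemma rk_add_box :
  is_permutation_tableau T -> is_permutation_tableau U -> rk U = (rk T).+1.
Proof.
move=> tabT tabU; apply/eqP; rewrite -(eqn_add2r (ncols U)) rk_ncols //.
by rewrite ones_add_box ncols_add_box addSn rk_ncols.
Qed.

Lemma f_stat_add_box : f_stat U = f_stat T.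
Proof. by rewrite /f_stat -!nth0 nth_set_nth /= eq_sym gtn_eqF. Qed.

(** The new box is a 1, so it is not a restricted 0, and it restricts nothing
    because it is the bottom of its column. *)
Lemma u_stat_add_box : u_stat U = u_stat T.
Proof.
rewrite /u_stat nrows_add_box; congr _.-1; apply: eq_count => a.
apply/unrestricted_rowP/unrestricted_rowP => unr a' j lt_a lt_j one_a'.
  have := unr a' j lt_a; rewrite row_length_add_box !is_one_add_box one_a' orbT.
  rewrite ltn_addl // => /(_ isT isT)/orP[/andP[/eqP eq_a /eqP eq_j]|//].
  by rewrite eq_a eq_j ltnn in lt_j.
rewrite is_one_add_box; move: one_a'; rewrite is_one_add_box.
case/orP=> [/andP[/eqP eq_a' /eqP eq_j]|one_a'].
  have := @below_add_box a; rewrite -eq_a' => /(_ lt_a).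
  by rewrite -eq_j leqNgt lt_j.
move: lt_j; rewrite row_length_add_box.
case: eqP => [eq_a|_] /= lt_j; last exact: (unr a').
have [-> //|ne_j] := eqVneq j l; apply: (unr a') => //.
by move: ne_j lt_j; rewrite /l eq_a; lia.
Qed.

Lemma add_box_tableau :
  is_permutation_tableau U -> one_above U i l -> is_permutation_tableau T.
Proof.
case/permutation_tableauP=> _ [U0 cols rule] /one_aboveP[a0 lt_a0 one_a0].
apply/permutation_tableauP; split=> //; split=> [|j lt_j|a j a' j' lt_a lt_j].
- by rewrite -nrows_add_box.
- have [|a] := cols j; first by rewrite ncols_add_box.
  rewrite is_one_add_box => /orP[/andP[_ /eqP ->]|]; last by exists a.
  by move: one_a0; rewrite is_one_add_box ltn_eqF //; exists a0.
move=> a_row one_a' one_left.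
have := rule a j a' j' lt_a lt_j.
rewrite row_length_add_box ltn_addl // !is_one_add_box one_a' one_left !orbT.
case/(_ isT isT isT)/orP => [/andP[/eqP eq_a /eqP eq_j]|//].
by rewrite eq_a eq_j ltnn in a_row.
Qed.

End Adding.
End Boxes.

(** * The moves as a change of the inserted line *)

(** The candidate moves of a tableau are indexed by its corners, the steps of
    the cycles by the common part and the length of the line; this transfers
    sums from one indexing to the other. *)
Lemma reindex_count (I : eqType) (J : finType) (r : seq I) (P : pred I)
    (Q : pred J) (g : J -> I) (G : I -> nat) (F : J -> nat) :
  uniq r -> {in Q &, injective g} ->
  (forall j, Q j -> [/\ g j \in r, P (g j) & G (g j) = F j]) ->
  (forall i, i \in r -> P i -> exists2 j, Q j & g j = i) ->
  (\sum_(i <- r | P i) G i = \sum_(j | Q j) F j)%N.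
Proof.
move=> uniq_r inj_g gQ surj_g; rewrite -big_filter.
have /(perm_big _)-> : perm_eq [seq i <- r | P i] (map g (enum Q)).
  apply: uniq_perm; first exact: filter_uniq.
    rewrite map_inj_in_uniq ?enum_uniq // => j j'.
    by rewrite !mem_enum; exact: inj_g.
  move=> i; rewrite mem_filter; apply/andP/mapP => [[Pi ri]|[j]].
    by have [j Qj gj] := surj_g i ri Pi; exists j => //; rewrite mem_enum.
  by rewrite mem_enum => Qj ->; have [] := gQ j Qj.
by rewrite big_map big_enum /=; apply: eq_bigr => j /gQ[].
Qed.

Section Moves.
Implicit Types (S T : filling) (i j l : nat).
Local Open Scope nat_scope.

Definition zero_corner S i := corner S i && is_zero S i (row_length S i).-1.

Definition superfluous_corner S i :=
  corner S i && superfluous S i (row_length S i).-1.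

(** The order of the tests follows [hop_right_at], where a necessary 1 is looked
    for only after a superfluous one. *)
Definition lone_corner S i :=
  [&& corner S i, ~~ superfluous S i (row_length S i).-1
    & necessary S i (row_length S i).-1].

Lemma count_hop_right S T :
  count_mem T (hop_right_targets S) =
    \sum_(i <- iota 1 (nrows S).-1 | zero_corner S i)
       (add_zero_row (row_length S i).-1 (delete_row i S) == T)
    + \sum_(i <- iota 1 (nrows S).-1 | superfluous_corner S i)
       (remove_box i S == T)
    + \sum_(i <- iota 1 (nrows S).-1 | lone_corner S i)
       (add_column i (delete_col (row_length S i).-1 S) == T).
Proof.
rewrite /hop_right_targets count_flatten sumnE !big_map big_filter.
rewrite [LHS]big_mkcond [X in _ = X + _ + _]big_mkcond.
rewrite [X in _ = _ + X + _]big_mkcond [X in _ = _ + X]big_mkcond.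
rewrite -!big_split /=; apply: eq_bigr => i _; rewrite -/(corner S i).
rewrite /zero_corner /superfluous_corner /lone_corner.
case: (corner S i) => //=; rewrite /hop_right_at.
set j := (row_length S i).-1.
have [/= zero_ij|not0] := boolP (is_zero S i j).
  have not1 : is_one S i j = false by case/andP: zero_ij => _ /negPf.
  by rewrite /superfluous /necessary not1 /= !addn0.
have [//=|not_sup] := boolP (superfluous S i j).
by have [//=|not_nec] := boolP (necessary S i j); rewrite ?addn0.
Qed.

Lemma corner_gt0 S i : corner S i -> 0 < row_length S i.
Proof. exact: leq_ltn_trans. Qed.

Lemma corner_nrows S i : corner S i -> i < nrows S.
Proof. by move/corner_gt0/row_length_nrows. Qed.

Lemma one_at_corner S i i' :
  partition_shape S -> corner S i -> is_one S i' (row_length S i).-1 -> i' <= i.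
Proof.
move=> srt cor /is_one_size lt_l; rewrite leqNgt; apply/negP=> lt_i.
have := partition_shapeP _ srt _ _ lt_i; move: cor lt_l; rewrite /corner; lia.
Qed.

(** The column of the corner has a 1 above the corner 0, so there is no 1 to
    the left of this 0. *)
Lemma zero_corner_row S i : is_permutation_tableau S -> zero_corner S i ->
  nth [::] S i = nseq (row_length S i) false.
Proof.
case/permutation_tableauP=> srt [_ cols rule] /andP[cor /andP[lt_l not1]].
have [|i' one'] := cols (row_length S i).-1.
  rewrite -row_length0; apply: leq_trans lt_l _; exact: (partition_shapeP _ srt).
have lt_i : i' < i.
  rewrite ltn_neqAle (one_at_corner srt cor one') andbT.
  by apply/eqP=> eq_i; move: not1; rewrite -{1}eq_i one'.
apply: (@eq_from_nth _ false) => [|j lt_j]; first by rewrite size_nseq.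
rewrite nth_nseq if_same; apply/negbTE/negP=> one_j.
have lt_jl : j < (row_length S i).-1.
  have ne_j : j != (row_length S i).-1 by apply: contraNneq not1 => <-.
  by move: lt_j ne_j; rewrite -/(row_length S i); lia.
by rewrite (rule _ _ _ _ lt_i lt_jl lt_l one' one_j) in not1.
Qed.

Lemma lone_corner_column S i i' : partition_shape S -> corner S i ->
  is_one S i (row_length S i).-1 -> ~~ superfluous S i (row_length S i).-1 ->
  is_one S i' (row_length S i).-1 = (i' == i).
Proof.
move=> srt cor one_i not_sup; apply/idP/eqP => [one'|->//].
apply/eqP; rewrite eqn_leq (one_at_corner srt cor one') /= leqNgt.
apply: contra not_sup => lt_i; rewrite /superfluous /topmost one_i negbK /=.
by apply/one_aboveP; exists i'.
Qed.

(** Nothing lies below a corner, so a 1 there that is topmost is alone in its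
    column. *)
Lemma lone_cornerE S i : partition_shape S -> corner S i ->
  lone_corner S i = is_one S i (row_length S i).-1
                    && ~~ superfluous S i (row_length S i).-1.
Proof.
move=> srt cor; rewrite /lone_corner cor /= /necessary.
have [one_i|] := boolP (is_one _ _ _); last by rewrite andbF.
have [//|not_sup] /= := boolP (superfluous _ _ _).
rewrite (eq_count (fun i' => lone_corner_column i' srt cor one_i not_sup)).
rewrite -/(count_mem _ _) count_uniq_mem ?iota_uniq // mem_iota add0n.
by rewrite (is_one_nrows one_i).
Qed.

Lemma delete_last_col_corner S i : partition_shape S -> corner S i ->
  (forall i', is_one S i' (row_length S i).-1 = (i' == i)) ->
  add_column i.+1 (delete_col (row_length S i).-1 S) = S.
Proof.
move=> srt cor col_i; have sz := ltn_predK (corner_gt0 cor).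
by apply: delete_colK => //; rewrite -ltnS sz.
Qed.

End Moves.

Lemma permtab_tableau n (T : permtab n) : is_permutation_tableau T.
Proof. by case/andP: (permtabP T). Qed.

Lemma permtab_half n (T : permtab n) : (nrows T + ncols T)%N = n.+1.
Proof. by case/andP: (permtabP T) => _ /eqP. Qed.

Lemma permtab_shape n (T : permtab n) : partition_shape T.
Proof. by case/permutation_tableauP: (permtab_tableau T). Qed.

Lemma permtab_nrows n (T : permtab n) : (0 < nrows T)%N.
Proof. by case/permutation_tableauP: (permtab_tableau T) => _ []. Qed.

#[local] Hint Resolve permtab_tableau permtab_shape permtab_nrows : core.

Section Permtabs.
Local Open Scope nat_scope.
Variable M : nat.
Implicit Types (B : permtab M) (S T : permtab M.+1).

Lemma ex_permtab n (X : filling) : is_permutation_tableau X ->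
  nrows X + ncols X = n.+1 -> exists T : permtab n, X = T.
Proof.
move=> tabX halfX.
have XP : is_permutation_tableau X && (half_perimeter X == n.+1).
  by rewrite tabX; apply/eqP.
by exists (PermTab XP).
Qed.

Lemma add_zero_row_permtab B l : l <= ncols B ->
  exists S : permtab M.+1, add_zero_row l B = S.
Proof.
move=> le_l; apply: ex_permtab; first by rewrite add_zero_row_tableau.
by rewrite nrows_add_zero_row ncols_add_zero_row // addSn permtab_half.
Qed.

Lemma add_column_permtab B h : 0 < h <= nrows B ->
  exists S : permtab M.+1, add_column h B = S.
Proof.
case/andP=> h0 le_h; apply: ex_permtab; first by rewrite add_column_tableau.
by rewrite nrows_add_column ncols_add_column // addnS permtab_half.
Qed.

(** Deleting a zero row is undone by [add_zero_row], so what remains inherits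
    the tableau conditions through [add_zero_row_tableau]. *)
Lemma delete_row_permtab S i : 0 < i < nrows S ->
  (row_length S i.+1 < row_length S i) || (i.+1 == nrows S) ->
  nth [::] S i = nseq (row_length S i) false ->
  exists2 B : permtab M, delete_row i S = B
    & (row_length S i <= ncols B) /\ add_zero_row (row_length S i) B = S.
Proof.
case/andP=> i_gt0 lt_i last_i row_i; set l := row_length S i.
have insS : add_zero_row l (delete_row i S) = S.
  by rewrite /add_zero_row -row_i delete_rowK.
have srt : partition_shape (delete_row i S) by exact: delete_row_shape.
have n0 : 0 < nrows (delete_row i S).
  by rewrite -ltnS -(nrows_add_zero_row l) insS; apply: leq_ltn_trans lt_i.
have cE : ncols (delete_row i S) = ncols S.
  by rewrite -!row_length0 /row_length /delete_row nth_cat size_takel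
    ?(ltnW lt_i) // i_gt0 nth_take.
have le_l : l <= ncols (delete_row i S).
  by rewrite cE -row_length0; exact: (partition_shapeP _ (permtab_shape S)).
have [||B defB] := @ex_permtab M (delete_row i S); last first.
- by exists B => //; rewrite -defB.
- apply: succn_inj; rewrite -addSn -(nrows_add_zero_row l).
  by rewrite -(ncols_add_zero_row srt n0 le_l) insS permtab_half.
by rewrite -(add_zero_row_tableau srt n0 le_l) insS.
Qed.

Lemma delete_col_permtab S i : corner S i ->
  (forall i', is_one S i' (row_length S i).-1 = (i' == i)) ->
  exists2 B : permtab M, delete_col (row_length S i).-1 S = B
    & (i < nrows B) /\ add_column i.+1 B = S.
Proof.
move=> cor col_i; set k := _.-1.
have insS : add_column i.+1 (delete_col k S) = S by exact: delete_last_col_corner.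
have srt : partition_shape (delete_col k S) by exact: delete_col_shape.
have lt_i : i < nrows (delete_col k S) by rewrite nrows_delete_col corner_nrows.
have [||B defB] := @ex_permtab M (delete_col k S); last first.
- by exists B => //; rewrite -defB.
- apply: succn_inj; rewrite -addnS -(ncols_add_column srt _ lt_i) // insS.
  by rewrite nrows_delete_col permtab_half.
by rewrite -(add_column_tableau srt _ lt_i) // insS.
Qed.

(** The step from C_1 to Z_n of the cycle of B. *)
Lemma count_enter S (T : filling) :
  count_mem T (enter_targets S) =
  \sum_(B : permtab M | add_column 1 B == S) (add_zero_row (ncols B) B == T).
Proof.
rewrite /enter_targets; set c := (0 < _) && _; set k := (ncols S).-1.
set X := insert_row _ _.
transitivity (\sum_(i <- [:: tt] | c) (X == T : nat)).
  by rewrite big_mkcond big_seq1; case: ifP => //= _; rewrite addn0.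
have slot (B : permtab M) : add_column 1 B = S -> ncols B = k.
  by move=> defS; rewrite /k -defS ncols_add_column.
apply: (reindex_count (g := fun _ => tt)) => //.
- move=> B B' /eqP defS /eqP defS' _; apply: val_inj => /=.
  rewrite -(add_columnK (h := 1) (B := B)) //.
  rewrite -(add_columnK (h := 1) (B := B')) // defS defS' /=.
  by rewrite !row_length0 (slot _ defS) (slot _ defS').
- move=> B /eqP defS; have kE := slot B defS.
  have BE : delete_col k S = B.
    by rewrite -kE -row_length0 -defS (add_columnK (h := 1)).
  split=> //; last by rewrite /X BE -/k -kE.
  rewrite /c -/k -{1}defS ncols_add_column //= eqn_leq leqNgt.
  rewrite -!lt_row_length // -defS !row_length_add_column //= -kE row_length0.
  rewrite add1n leqnn andbT -leqNgt -row_length0.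
  exact: (partition_shapeP _ (permtab_shape B)).
case=> _; rewrite /c -/k => /andP[c_gt0 /eqP col1].
have rl1 : row_length S 1 <= k by rewrite leqNgt lt_row_length // col1.
have rl0 : row_length S 0 = k.+1 by rewrite row_length0 prednK.
have cor : corner S 0 by rewrite /corner rl0.
have [] := @delete_col_permtab S 0 cor; last first.
  by move=> B _ [_ defS]; exists B => //; apply/eqP.
rewrite rl0 /= => i.
have only0 a : is_one S a k -> a = 0.
  by move/is_one_size; rewrite lt_row_length // col1; case: a.
apply/idP/eqP => [/only0//|->].
have [_ [_ cols _]] := permutation_tableauP _ (permtab_tableau S).
have [|a one_a] := cols k; first by rewrite -row_length0 rl0.
by rewrite -(only0 a one_a).
Qed.

(** The step from Z_0 to C_m of the cycle of B. *)
Lemma count_exit S (T : filling) :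
  count_mem T (exit_targets S) =
  \sum_(B : permtab M | add_zero_row 0 B == S) (add_column (nrows B) B == T).
Proof.
rewrite /exit_targets; set c := (1 < _) && _; set k := (nrows S).-1.
set X := insert_col _ _.
transitivity (\sum_(i <- [:: tt] | c) (X == T : nat)).
  by rewrite big_mkcond big_seq1; case: ifP => //= _; rewrite addn0.
have slot (B : permtab M) : row_slot 0 B = nrows B.
  by rewrite /row_slot (@eq_count _ _ xpredT) // count_predT.
have kE (B : permtab M) : add_zero_row 0 B = S -> nrows B = k.
  by move=> defS; rewrite /k -defS nrows_add_zero_row.
have delE (B : permtab M) : add_zero_row 0 B = S -> delete_row k S = B.
  move=> defS; rewrite -(kE B defS) -slot -[in LHS]defS.
  exact: (insert_rowK (nseq 0 false)).
apply: (reindex_count (g := fun _ => tt)) => //.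
- move=> B B' /eqP defS /eqP defS' _; apply: val_inj => /=.
  by rewrite -(delE B) // (delE B').
- move=> B /eqP defS; split=> //; last first.
    by rewrite /X -/k (delE B) // (kE B).
  rewrite /c -/k -(kE B defS) -slot -{1 2}defS nrows_add_zero_row ltnS.
  by rewrite permtab_nrows row_length_new_zero_row.
case=> _; rewrite /c -/k => /andP[n_gt1 /eqP len0].
have [||| B _ [_]] := @delete_row_permtab S k; last first.
- by rewrite len0 => defS; exists B => //; apply/eqP.
- by rewrite len0; apply: size0nil.
- by rewrite /k prednK ?eqxx ?orbT.
by rewrite /k; case: (nrows S) n_gt1 => [|[|n]] //=.
Qed.

(** The steps from Z_(l+1) to Z_l.  The index l < ncols B fits in 'I_M.+1
    because B has half-perimeter M.+1. *)
Lemma count_zero_corners S (T : filling) :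
  \sum_(i <- iota 1 (nrows S).-1 | zero_corner S i)
     (add_zero_row (row_length S i).-1 (delete_row i S) == T) =
  \sum_(x : permtab M * 'I_M.+1
       | (x.2 < ncols x.1) && (add_zero_row x.2.+1 x.1 == S))
     (add_zero_row x.2 x.1 == T).
Proof.
apply: (reindex_count (g := fun x : permtab M * 'I_M.+1 => row_slot x.2.+1 x.1)).
- exact: iota_uniq.
- move=> [B l] [B' l'] /andP[/= lt_l /eqP defS] /andP[/= lt_l' /eqP defS'] eq_i.
  have := row_length_new_zero_row l.+1 B.
  have := row_length_new_zero_row l'.+1 B'.
  rewrite defS defS' eq_i => -> [/val_inj ->]; congr (_, _).
  apply: val_inj => /=; rewrite -(insert_rowK (nseq l.+1 false) B).
  rewrite -(insert_rowK (nseq l'.+1 false) B') !size_nseq.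
  by rewrite -!/(add_zero_row _ _) defS defS' eq_i.
- move=> [B l] /andP[/= lt_l /eqP defS]; set i := row_slot _ _.
  have len_i : row_length S i = l.+1 by rewrite -defS row_length_new_zero_row.
  have not1 j : is_one S i j = false by rewrite -defS is_one_new_zero_row.
  have i_gt0 : 0 < i by rewrite add_zero_row_slot.
  have le_i : i <= nrows B by exact: row_slot_le.
  split.
  + by rewrite mem_iota i_gt0 add1n -defS nrows_add_zero_row.
  + rewrite /zero_corner /corner /is_zero not1 len_i /= ltnSn andbT ltnS.
    have -> : row_length S i.+1 = row_length B i.
      rewrite -(row_length_add_zero_row l.+1 B i) defS.
      by congr row_length; rewrite /bump leqnn.
    have [/row_length_default->//|lt_i] := leqP (nrows B) i.
    by rewrite leqNgt -lt_row_slot // ltnn.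
  rewrite len_i -defS /i -[X in row_slot X](size_nseq l.+1 false).
  by rewrite insert_rowK.
move=> i; rewrite mem_iota => /andP[i_gt0 lt_i] zc.
have row_i := zero_corner_row (permtab_tableau S) zc.
have /andP[cor _] := zc; have lt_iS := corner_nrows cor.
have len_i := ltn_predK (corner_gt0 cor).
have [|| B defB []] := @delete_row_permtab S i _ _ row_i.
- by rewrite i_gt0.
- by rewrite -/(corner S i) cor.
move=> le_B defS; have lt_M : (row_length S i).-1 < M.+1.
  rewrite len_i; apply: leq_trans le_B _; rewrite -(permtab_half B).
  exact: leq_addl.
exists (B, Ordinal lt_M) => /=; first by rewrite len_i le_B defS eqxx.
rewrite len_i -defB row_slot_delete_row //.
by rewrite -/(corner S i) cor.
Qed.

(** The steps from C_(h+1) to C_h for 0 < h < m, where h is [x.2.+1]. *)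
Lemma count_lone_corners S (T : filling) :
  \sum_(i <- iota 1 (nrows S).-1 | lone_corner S i)
     (add_column i (delete_col (row_length S i).-1 S) == T) =
  \sum_(x : permtab M * 'I_M.+1
       | (x.2 < (nrows x.1).-1) && (add_column x.2.+2 x.1 == S))
     (add_column x.2.+1 x.1 == T).
Proof.
have le_h (B : permtab M) h : h < (nrows B).-1 -> h.+2 <= nrows B.
  by move=> lt_h; rewrite -(prednK (permtab_nrows B)) ltnS.
have delE (B : permtab M) h : h < (nrows B).-1 -> add_column h.+2 B = S ->
    row_length S h.+1 = (row_length B h.+1).+1 /\
    delete_col (row_length B h.+1) S = B.
  move=> /le_h lt_h defS; rewrite -defS row_length_add_column // ltnSn.
  by split=> //; exact: (add_columnK (h := h.+2)).
apply: (reindex_count (g := fun x : permtab M * 'I_M.+1 => x.2.+1)).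
- exact: iota_uniq.
- move=> [B h] [B' h'] /andP[/= lt_h /eqP defS] /andP[/= lt_h' /eqP defS'] [].
  move=> eq_h; congr (_, _); last exact: val_inj.
  apply: val_inj => /=.
  have [len_i <-] := delE _ _ lt_h defS; have [] := delE _ _ lt_h' defS'.
  by rewrite -eq_h len_i => -[->].
- move=> [B h] /andP[/= lt_h /eqP defS]; have lt_hB := le_h _ _ lt_h.
  have [len_i delB] := delE _ _ lt_h defS.
  have one_i i : is_one S i (row_length B h.+1) = (i == h.+1).
    by rewrite -defS (is_one_new_column (h := h.+2)).
  split; last by rewrite len_i /= delB.
    by rewrite mem_iota /= add1n -defS nrows_add_column ltnS.
  have cor : corner S h.+1.
    rewrite /corner len_i ltnS -defS row_length_add_column // ltnn add0n.
    exact: (partition_shapeP _ (permtab_shape B)).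
  rewrite lone_cornerE // len_i /= /superfluous /topmost one_i eqxx negbK /=.
  by apply/one_aboveP=> -[i lt_i]; rewrite one_i ltn_eqF.
move=> i; rewrite mem_iota => /andP[i_gt0 _] lc.
have [||B defB [lt_i defS]] := @delete_col_permtab S i.
- by case/and3P: lc.
- by move=> i'; apply: lone_corner_column; case/and3P: lc => // _ _ /andP[].
have lt_M : i.-1 < M.+1.
  rewrite prednK //; apply: leq_trans (ltnW lt_i) _.
  by rewrite -(permtab_half B) leq_addr.
exists (B, Ordinal lt_M) => /=; last exact: prednK.
by rewrite prednK // defS eqxx andbT -ltnS !prednK.
Qed.

End Permtabs.

(** * Weights along the moves *)

Section HopLeft.
Local Open Scope nat_scope.
Implicit Types (S T : filling).

Lemma remove_box_shape S i :
  partition_shape S -> corner S i -> partition_shape (remove_box i S).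
Proof.
move=> /partition_shapeP mono cor; apply/partition_shapeP => a b le_ab.
rewrite !row_length_remove_box; have := mono _ _ le_ab.
case: (eqVneq a i) => [eq_a|_]; case: (eqVneq b i) => [_|ne_b]; try lia.
have /mono : i.+1 <= b by lia.
by move: cor; rewrite /corner eq_a; lia.
Qed.

(** A hop to the left from T to S is undone by exactly one hop to the right, at
    the row of the new box. *)
Lemma remove_add_box S T i :
  is_permutation_tableau S -> is_permutation_tableau T ->
  i.+1 < nrows S -> i.+1 < nrows T ->
  superfluous_corner S i.+1 && (remove_box i.+1 S == T)
  = (row_length T i.+1 < row_length T i) && (add_box i.+1 T == S).
Proof.
case/permutation_tableauP=> srtS _ tabT lt_S lt_T.
have srtT : partition_shape T by case/permutation_tableauP: tabT.
apply/andP/andP=> -[].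
  case/andP=> cor /andP[one_i _] /eqP defT; split; last first.
    by rewrite -defT remove_boxK.
  rewrite -defT !row_length_remove_box eqxx ltn_eqF //.
  have := partition_shapeP _ srtS i i.+1 (leqnSn i); have := corner_gt0 cor; lia.
move=> short_i /eqP defS; split; last by rewrite -defS add_boxK.
by rewrite -defS /superfluous_corner corner_add_box // superfluous_add_box.
Qed.

Lemma count_hop_left S T :
  is_permutation_tableau S -> is_permutation_tableau T ->
  count_mem S (hop_left_targets T)
  = \sum_(i <- iota 1 (nrows S).-1 | superfluous_corner S i) (remove_box i S == T).
Proof.
move=> tabS tabT.
have -> : count_mem S (hop_left_targets T) =
    \sum_(i <- iota 0 (nrows T).-1 | row_length T i.+1 < row_length T i)
      (add_box i.+1 T == S).
  rewrite /hop_left_targets count_map count_filter -sum1_count.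
  rewrite [LHS]big_mkcond [RHS]big_mkcond; apply: eq_bigr => i _ /=.
  by rewrite /add_box; case: (_ == S); case: (row_length T i.+1 < row_length T i).
rewrite (iotaDl 1 0) big_map.
have [eq_n|ne_n] := eqVneq (nrows S) (nrows T); last first.
  rewrite big_seq_cond big1 => [|i /andP[]]; last first.
    rewrite mem_iota => lt_i _; apply/eqP; rewrite eqb0.
    apply: contraNneq ne_n => <-; rewrite nrows_set_row //; lia.
  rewrite big1 => [|i /andP[cor _]] //; apply/eqP; rewrite eqb0.
  by apply: contraNneq ne_n => <-; rewrite nrows_set_row // corner_nrows.
rewrite -eq_n big_seq_cond [RHS]big_seq_cond.
rewrite [LHS]big_mkcond [RHS]big_mkcond; apply: eq_bigr => i _.
rewrite add1n; case mem_i: (i \in _) => //=.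
have lt_i : i.+1 < nrows S by move: mem_i; rewrite mem_iota; lia.
have := @remove_add_box S T i tabS tabT lt_i; rewrite -eq_n => /(_ lt_i).
case: (superfluous_corner S i.+1); case: (row_length T i.+1 < row_length T i);
  by case: (_ == T); case: (_ == S).
Qed.

End HopLeft.

Section Weights.
Local Open Scope ring_scope.
Variables (R : realFieldType) (alpha beta q : R).
Hypotheses (alpha_gt0 : 0 < alpha) (beta_gt0 : 0 < beta).
Local Notation wt := (wt alpha beta q).

Let alpha_neq0 : alpha != 0. Proof. exact: lt0r_neq0. Qed.
Let beta_neq0 : beta != 0. Proof. exact: lt0r_neq0. Qed.

(** An empty row is unrestricted, a longer zero row is not; [beta] is the rate
    out of Z_0. *)
Lemma wt_add_zero_row M (B : permtab M) (S : permtab M.+1) l :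
  (l <= ncols B)%N -> add_zero_row l B = S ->
  (if l == 0%N then beta else 1) * wt S = wt B.
Proof.
move=> le_l defS; rewrite /Defs.wt -defS rk_add_zero_row // f_stat_add_zero_row //.
rewrite u_stat_add_zero_row //; case: (l == 0%N); last by rewrite mul1r.
by rewrite add1n exprS invfM mulrCA mulVKf.
Qed.

(** Only a column of length 1 has its 1 in the first row; [alpha] is the rate
    out of C_1. *)
Lemma wt_add_column M (B : permtab M) (S : permtab M.+1) h :
  (0 < h <= nrows B)%N -> add_column h B = S ->
  (if h == 1%N then alpha else 1) * wt S = wt B.
Proof.
case/andP=> h0 le_h defS; rewrite /Defs.wt -defS rk_add_column //.
rewrite u_stat_add_column // f_stat_add_column //.
case: (h == 1%N); last by rewrite mul1r.
by rewrite add1n exprS invfM mulrA [X in X * _]mulrCA mulVKf.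
Qed.

(** Adding a superfluous 1 raises the rank by one and keeps the first row and
    the set of unrestricted rows. *)
Lemma wt_hop_left n (S T : permtab n) :
  (S : filling) \in hop_left_targets T -> wt S = q * wt T.
Proof.
case/mapP=> i; rewrite mem_filter mem_iota => /andP[short_i lt_i] defS.
have lt_i1 : (i.+1 < nrows T)%N by move: lt_i; lia.
have tabS := permtab_tableau S; rewrite defS -/(add_box _ _) in tabS.
rewrite /Defs.wt defS -!/(add_box i.+1 T).
rewrite rk_add_box // f_stat_add_box // u_stat_add_box //.
by rewrite exprS !mulrA.
Qed.

(** On the left the hops to the right that remove a superfluous 1, on the right
    the hops to the left that put it back. *)
Lemma detailed_balance n (S T : permtab n) :
  wt S * (\sum_(i <- iota 1 (nrows S).-1 | superfluous_corner S i)
            (remove_box i S == T :> filling))%:R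
  = wt T * (q * (count_mem (S : filling) (hop_left_targets T))%:R).
Proof.
rewrite -count_hop_left //.
have [/wt_hop_left->|/count_memPn->] :=
  boolP ((S : filling) \in hop_left_targets T).
  by rewrite mulrA [_ * q]mulrC.
by rewrite !mulr0.
Qed.

End Weights.

(** * Balance of the flow *)

Section Flows.
Local Open Scope ring_scope.
Variables (R : realFieldType) (n : nat) (J : finType) (a : pred J).
Variables (src tgt : J -> filling) (w : J -> R).
Hypothesis src_permtab : forall x, a x -> exists S : permtab n, src x = S.
Hypothesis tgt_permtab : forall x, a x -> exists S : permtab n, tgt x = S.

(** A family of edges, indexed by x, carries the amount w x from src x to
    tgt x; this is the total amount carried from S to T. *)
Definition flow (S T : filling) : R :=
  \sum_(x | a x && (src x == S)) w x * (tgt x == T)%:R.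

Lemma sum_permtab_eq (X : filling) (c : R) : (exists S : permtab n, X = S) ->
  \sum_(S : permtab n) c * (X == S :> filling)%:R = c.
Proof.
move=> [S0 ->]; rewrite (bigD1 S0) //= eqxx mulr1 big1 ?addr0 // => S ne_S.
by rewrite [_ == _](_ : _ = (S0 == S)) // eq_sym (negPf ne_S) mulr0.
Qed.

(** Every edge has both ends among the states, so only the edges incident with
    T contribute. *)
Lemma flow_divergence (T : filling) :
  \sum_(S : permtab n) flow S T - \sum_(S : permtab n) flow T S
  = \sum_(x | a x) w x * ((tgt x == T)%:R - (src x == T)%:R).
Proof.
under [RHS]eq_bigr do rewrite mulrBr.
rewrite sumrB; congr (_ - _).
  rewrite /flow; under eq_bigr do rewrite big_mkcondr.
  rewrite exchange_big; apply: eq_bigr => x ax /=.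
  rewrite -[RHS](sum_permtab_eq _ (src_permtab ax)); apply: eq_bigr => S _.
  by case: eqP; rewrite ?mulr1 ?mulr0.
rewrite /flow exchange_big big_mkcondr; apply: eq_bigr => x ax /=.
rewrite (sum_permtab_eq _ (tgt_permtab ax)).
by case: eqP; rewrite ?mulr1 ?mulr0.
Qed.

End Flows.

Section Balance.
Local Open Scope ring_scope.
Variables (R : realFieldType) (M : nat) (alpha beta q : R).
Hypotheses (alpha_gt0 : 0 < alpha) (beta_gt0 : 0 < beta).
Implicit Types (S T : permtab M.+1) (B : permtab M).
Local Notation wt := (wt alpha beta q).
Local Notation pairs := (permtab M * 'I_M.+1)%type.

Let enter_flow :=
  flow xpredT (fun B => add_column 1 B) (fun B => add_zero_row (ncols B) B)
    (fun B => wt B).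
Let shorten_row_flow :=
  flow (fun x : pairs => x.2 < ncols x.1)%N
    (fun x => add_zero_row x.2.+1 x.1) (fun x => add_zero_row x.2 x.1)
    (fun x => wt x.1).
Let exit_flow :=
  flow xpredT (fun B => add_zero_row 0 B) (fun B => add_column (nrows B) B)
    (fun B => wt B).
Let shorten_col_flow :=
  flow (fun x : pairs => x.2 < (nrows x.1).-1)%N
    (fun x => add_column x.2.+2 x.1) (fun x => add_column x.2.+1 x.1)
    (fun x => wt x.1).

Lemma enter_flowE S T :
  wt S * (alpha * (count_mem (T : filling) (enter_targets S))%:R)
  = enter_flow S T.
Proof.
rewrite count_enter natr_sum !mulr_sumr; apply: eq_bigr => B /eqP defS.
rewrite mulrA [wt S * _]mulrC.
by rewrite (wt_add_column (h := 1) beta q alpha_gt0 _ defS) //=.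
Qed.

Lemma exit_flowE S T :
  wt S * (beta * (count_mem (T : filling) (exit_targets S))%:R) = exit_flow S T.
Proof.
rewrite count_exit natr_sum !mulr_sumr; apply: eq_bigr => B /eqP defS.
rewrite mulrA [wt S * _]mulrC.
by rewrite (wt_add_zero_row (l := 0) alpha q beta_gt0 _ defS).
Qed.

Lemma shorten_row_flowE S T :
  wt S * (\sum_(i <- iota 1 (nrows S).-1 | zero_corner S i)
     (add_zero_row (row_length S i).-1 (delete_row i S) == T :> filling))%:R
  = shorten_row_flow S T.
Proof.
rewrite count_zero_corners natr_sum mulr_sumr; apply: eq_bigr => x.
case/andP=> lt_x /eqP defS; congr (_ * _).
by have := wt_add_zero_row alpha q beta_gt0 lt_x defS; rewrite mul1r.
Qed.

Lemma shorten_col_flowE S T :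
  wt S * (\sum_(i <- iota 1 (nrows S).-1 | lone_corner S i)
     (add_column i (delete_col (row_length S i).-1 S) == T :> filling))%:R
  = shorten_col_flow S T.
Proof.
rewrite count_lone_corners natr_sum mulr_sumr; apply: eq_bigr => x.
case/andP=> lt_x /eqP defS; congr (_ * _).
have := wt_add_column beta q alpha_gt0 _ defS; rewrite mul1r; apply=> /=.
by rewrite -(prednK (permtab_nrows x.1)) ltnS.
Qed.

Lemma sum_pairs (b : permtab M -> nat) (F : permtab M -> nat -> R) :
  (forall B, (b B <= M.+1)%N) ->
  \sum_(x : pairs | (x.2 < b x.1)%N) F x.1 x.2
  = \sum_B \sum_(0 <= l < b B) F B l.
Proof.
move=> le_b; rewrite -(pair_big_dep xpredT (fun B (l : 'I_M.+1) => l < b B)%N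
  (fun B (l : 'I_M.+1) => F B l)) /=.
by apply: eq_bigr => B _; rewrite big_mkord (big_ord_widen _ _ (le_b B)).
Qed.

Let circulation (S T : filling) : R :=
  enter_flow S T + shorten_row_flow S T + exit_flow S T + shorten_col_flow S T.

(** For each B the steps along rows telescope to Z_0 - Z_n and those along
    columns to C_1 - C_m; the steps of entering and exiting close the cycle. *)
Lemma circulation_balanced T :
  \sum_(S : permtab M.+1) circulation S T
  = \sum_(S : permtab M.+1) circulation T S.
Proof.
apply/eqP; rewrite -subr_eq0 /circulation !big_split /=.
have arrange (a b c d a' b' c' d' : R) : a + b + c + d - (a' + b' + c' + d')
    = (a - a') + (b - b') + (c - c') + (d - d') by ring.
have le_c B : (ncols B <= M.+1)%N by rewrite -(permtab_half B) leq_addl.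
have le_r B : ((nrows B).-1 <= M.+1)%N.
  by rewrite -(permtab_half B); apply: leq_trans (leq_pred _) (leq_addr _ _).
rewrite arrange !flow_divergence; first last.
- by move=> B _; apply: add_zero_row_permtab.
- by move=> B _; apply: add_column_permtab; rewrite /= permtab_nrows.
- by move=> x lt_x; apply: add_zero_row_permtab; exact: ltnW.
- by move=> x lt_x; apply: add_zero_row_permtab.
- by move=> B _; apply: add_column_permtab; rewrite permtab_nrows /=.
- by move=> B _; apply: add_zero_row_permtab.
- move=> x lt_x; apply: add_column_permtab => /=.
  by apply: leq_trans (leq_pred (nrows x.1)).
- move=> x lt_x; apply: add_column_permtab => /=.
  by rewrite -(prednK (permtab_nrows x.1)) ltnS.
rewrite (@sum_pairs ncols (fun B l => wt B *
  ((add_zero_row l B == T)%:R - (add_zero_row l.+1 B == T)%:R))) //.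
rewrite (@sum_pairs (fun B => (nrows B).-1) (fun B h => wt B *
  ((add_column h.+1 B == T)%:R - (add_column h.+2 B == T)%:R))) //.
rewrite -!big_split /= big1 // => B _; rewrite -!mulr_sumr -!mulrDr.
(* Minus signs, because the cycle runs towards smaller lengths whereas the
   sums telescope upwards. *)
pose z l : R := - (add_zero_row l B == T)%:R.
pose c h : R := - (add_column h.+1 B == T)%:R.
have -> : \sum_(0 <= l < ncols B)
    ((add_zero_row l B == T)%:R - (add_zero_row l.+1 B == T)%:R : R)
    = z (ncols B) - z 0%N.
  rewrite -telescope_sumr //; apply: eq_bigr => l _.
  by rewrite /z opprK addrC.
have -> : \sum_(0 <= h < (nrows B).-1)
    ((add_column h.+1 B == T)%:R - (add_column h.+2 B == T)%:R : R)
    = c (nrows B).-1 - c 0%N.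
  rewrite -telescope_sumr //; apply: eq_bigr => h _.
  by rewrite /c opprK addrC.
rewrite /z /c prednK ?permtab_nrows //; apply/eqP; rewrite mulf_eq0.
by apply/orP; right; apply/eqP; ring.
Qed.

(** The circulation has as much inflow as outflow at T; the two remaining kinds
    of moves exchange their roles when S and T are exchanged. *)
Lemma PT_move_balance T :
  \sum_(S : permtab M.+1) wt S * PT_move_prob alpha beta q S T
  = wt T * \sum_(S : permtab M.+1) PT_move_prob alpha beta q T S.
Proof.
pose pop S T := (\sum_(i <- iota 1 (nrows S).-1 | superfluous_corner S i)
                   (remove_box i S == T :> filling))%N.
pose hop S T := count_mem (T : filling) (hop_left_targets S).
have moveE S U : wt S * PT_move_prob alpha beta q S U =
    (circulation S U + (wt S * (pop S U)%:R + wt S * (q * (hop S U)%:R)))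
      / M.+2%:R.
  rewrite /PT_move_prob mulrA; congr (_ / _).
  rewrite count_hop_right !natrD !mulrDr.
  rewrite enter_flowE exit_flowE shorten_row_flowE shorten_col_flowE.
  by rewrite /circulation /pop /hop; ring.
rewrite mulr_sumr; under eq_bigr do rewrite moveE.
under [RHS]eq_bigr do rewrite moveE.
rewrite -!mulr_suml; congr (_ / _).
rewrite big_split [RHS]big_split /= circulation_balanced; congr (_ + _).
apply: eq_bigr => S _; rewrite addrC; congr (_ + _).
  by rewrite detailed_balance.
by rewrite detailed_balance.
Qed.

End Balance.

(** * Reaching the tableau without columns *)

Section Descent.
Local Open Scope nat_scope.
Variable M : nat.
Implicit Types (S T : permtab M.+1) (B : permtab M).

(** The factor [M.+2] makes the loss of a column outweigh the zero row, of
    length at most M, that replaces it when a particle enters. *)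
Definition height (X : filling) := M.+2 * ncols X + sumn (map size X).

Definition only_rows : filling := nseq M.+2 [::].

Lemma only_rows_tableau : is_permutation_tableau only_rows.
Proof.
have len i : row_length only_rows i = 0 by rewrite /row_length nth_nseq if_same.
apply/permutation_tableauP; split; last split=> //.
  by apply/partition_shapeP=> i j _; rewrite !len.
by move=> i j i' j' _ _; rewrite len.
Qed.

Lemma eq_only_rows S : ncols S = 0 -> S = only_rows :> filling.
Proof.
move=> c0; have n_S : nrows S = M.+2 by rewrite -(permtab_half S) c0 addn0.
apply: (@eq_from_nth _ [::]) => [|i _]; first by rewrite size_nseq.
rewrite nth_nseq if_same; apply: size0nil; apply/eqP; rewrite -leqn0 -c0.
by rewrite -row_length0; apply: (partition_shapeP _ (permtab_shape S)).
Qed.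

Lemma sum_bool_gt0 (I : finType) (P p : pred I) :
  0 < \sum_(x | P x) (p x : nat) -> exists2 x, P x & p x.
Proof.
rewrite lt0n sum_nat_eq0 negb_forall => /existsP[x].
by rewrite negb_imply => /andP[Px]; rewrite eqb0 negbK; exists x.
Qed.

Lemma remove_box_permtab S i : 0 < i -> superfluous_corner S i ->
  exists2 T : permtab M.+1, remove_box i S = T & height T < height S.
Proof.
move=> i_gt0 /andP[cor sup]; set X := remove_box i S.
have lt_i : i < nrows X by rewrite nrows_set_row corner_nrows.
have one_i : is_one S i (row_length S i).-1 by case/andP: sup.
have defS : add_box i X = S := remove_boxK one_i.
have srt : partition_shape X by rewrite remove_box_shape.
have tabX : is_permutation_tableau X.
  apply: (add_box_tableau (i := i)) => //; rewrite defS //.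
  rewrite row_length_remove_box eqxx subn1.
  by case/andP: sup => _; rewrite negb_and one_i /= negbK.
have [|T defT] := @ex_permtab M.+1 X tabX.
  by rewrite -(nrows_add_box lt_i) -(ncols_add_box X i_gt0) defS permtab_half.
exists T => //; rewrite -defT /height -(ncols_add_box X i_gt0) -defS.
by rewrite area_add_box // addnS.
Qed.

(** If the last column has length 1, a particle can enter.  Otherwise its
    bottom box is a corner below the first row, where a particle hops right:
    this keeps the number of columns and removes one box. *)
Lemma descent_move S : S != only_rows :> filling ->
  exists2 T : permtab M.+1, height T < height S
    & 0 < count_mem (T : filling) (enter_targets S)
          + count_mem (T : filling) (hop_right_targets S).
Proof.
move=> neS; have c_gt0 : 0 < ncols S.
  by rewrite lt0n; apply: contraNneq neS => /eq_only_rows ->.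
set k := (ncols S).-1; set i := (col_length S k).-1.
have kE : k.+1 = ncols S by rewrite prednK.
have col_gt0 : 0 < col_length S k by rewrite -lt_row_length // row_length0 -kE.
have iE : i.+1 = col_length S k by rewrite prednK.
have len_i : row_length S i = k.+1.
  apply/eqP; rewrite eqn_leq lt_row_length // -iE leqnn andbT kE -row_length0.
  exact: (partition_shapeP _ (permtab_shape S)).
have cor : corner S i.
  by rewrite /corner len_i ltnS leqNgt lt_row_length // -iE ltnn.
have lt_i := corner_nrows cor.
(* Row i contains the bottom box of the last column. *)
have [i0|i_gt0] := posnP i.
  pose X := insert_row (nseq k false) (delete_col k S).
  have cnt : 0 < count_mem X (enter_targets S).
    by rewrite /enter_targets c_gt0 -/k -iE i0 /= eqxx.
  have := cnt; rewrite count_enter => /sum_bool_gt0[B /eqP defS /eqP defX].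
  have [T defT] := add_zero_row_permtab (leqnn (ncols B)).
  exists T; last by rewrite -defT defX addn_gt0 cnt.
  have := permtab_half B; have := permtab_nrows B.
  rewrite -defT -defS /height ncols_add_zero_row // ncols_add_column //.
  by rewrite area_add_zero_row area_add_column // mulnS; lia.
have mem_i : i \in iota 1 (nrows S).-1 by rewrite mem_iota i_gt0 add1n prednK.
have term_gt0 (P p : pred nat) : P i -> p i ->
    0 < \sum_(i <- iota 1 (nrows S).-1 | P i) (p i : nat).
  by move=> Pi p_i; rewrite (big_rem i) //= Pi p_i.
suff [T lt_T cntT] : exists2 T : permtab M.+1, height T < height S
    & 0 < count_mem (T : filling) (hop_right_targets S).
  by exists T => //; rewrite addn_gt0 cntT orbT.
have [zero_i|not0] := boolP (is_zero S i k).
  have zc : zero_corner S i by rewrite /zero_corner cor len_i.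
  pose X := add_zero_row (row_length S i).-1 (delete_row i S).
  have cnt : 0 < \sum_(i <- iota 1 (nrows S).-1 | zero_corner S i)
      (add_zero_row (row_length S i).-1 (delete_row i S) == X).
    exact: term_gt0.
  have := cnt; rewrite (count_zero_corners (M := M)).
  case/sum_bool_gt0=> -[B l] /andP[/= lt_l /eqP defS] /eqP defX.
  have [T defT] := add_zero_row_permtab (ltnW lt_l).
  exists T; last by rewrite count_hop_right -defT defX -addnA ltn_addr.
  rewrite -defT -defS /height !ncols_add_zero_row // ?(ltnW lt_l) //.
  by rewrite !area_add_zero_row addSn addnS.
have one_i : is_one S i k.
  by move: not0; rewrite /is_zero len_i ltnSn negbK.
have [sup|not_sup] := boolP (superfluous S i k).
  have sc : superfluous_corner S i by rewrite /superfluous_corner cor len_i.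
  have [T defT lt_T] := remove_box_permtab i_gt0 sc.
  exists T => //; rewrite count_hop_right addn_gt0 addn_gt0; apply/orP; left.
  by apply/orP; right; apply: term_gt0 => //; apply/eqP.
have lc : lone_corner S i by rewrite lone_cornerE // len_i one_i.
pose X := add_column i (delete_col (row_length S i).-1 S).
have cnt : 0 < \sum_(i <- iota 1 (nrows S).-1 | lone_corner S i)
    (add_column i (delete_col (row_length S i).-1 S) == X).
  exact: term_gt0.
have := cnt; rewrite (count_lone_corners (M := M)).
case/sum_bool_gt0=> -[B h] /andP[/= lt_h /eqP defS] /eqP defX.
have le_h : h.+2 <= nrows B by rewrite -(prednK (permtab_nrows B)) ltnS.
have [|T defT] := @add_column_permtab M B h.+1; first by rewrite /= ltnW.
exists T; last by rewrite count_hop_right -defT defX ltn_addl.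
rewrite -defT -defS /height !ncols_add_column // ?(ltnW le_h) //.
by rewrite !area_add_column // ?(ltnW le_h) // !addSn !addnS.
Qed.

End Descent.

Local Open Scope ring_scope.

Theorem theorem5p1 (R : realFieldType) (N : nat) (alpha beta q : R)
    (hN : (1 <= N)%N) (halpha : 0 < alpha) (hbeta : 0 < beta) (hq : 0 <= q)
    (hprob : forall S T : permtab N, 0 <= PT_chain alpha beta q S T <= 1) :
  is_steady_state (@PT_chain R N alpha beta q)
    (fun T : permtab N =>
       wt alpha beta q T / \sum_(S : permtab N) wt alpha beta q S).
Proof.
case: N hN hprob => // M _ hprob.
have [|e def_e] := @ex_permtab M.+1 _ (only_rows_tableau M).
  by rewrite /nrows size_nseq addn0.
have wt_ge0 (T : permtab M.+1) : 0 <= wt alpha beta q T.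
  by rewrite !mulr_ge0 ?invr_ge0 ?exprn_ge0 // ltW.
have wt_e : 0 < wt alpha beta q e.
  have rk_e : rk e = 0%N.
    apply/eqP; rewrite -leqn0; apply: leq_trans (leq_addr (ncols e) _) _.
    by rewrite rk_ncols // -def_e /ones map_nseq sumn_nseq.
  by rewrite /wt rk_e mul1r mulr_gt0 ?invr_gt0 ?exprn_gt0.
set Z := \sum_S _.
have Z_gt0 : 0 < Z.
  by rewrite /Z (bigD1 e) //= ltr_wpDr // sumr_ge0.
have chain_ge0 (S T : permtab M.+1) : 0 <= PT_chain alpha beta q S T.
  by case/andP: (hprob S T).
have chain_sum1 (S : permtab M.+1) : \sum_T PT_chain alpha beta q S T = 1.
  rewrite (bigD1 S) //= {1}/PT_chain eqxx.
  rewrite -[RHS](subrK (\sum_(T' | T' != S) PT_move_prob alpha beta q S T')).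
  congr (_ + _); apply: eq_bigr => T /negPf ne_T.
  by rewrite /PT_chain ne_T.
have wt_stationary : is_stationary (@PT_chain R M.+1 alpha beta q)
    (fun T : permtab M.+1 => wt alpha beta q T / Z).
  split=> [S||T]; first by rewrite divr_ge0 // ltW.
    by rewrite -mulr_suml divff // gt_eqF.
  under eq_bigr do rewrite mulrAC.
  rewrite -mulr_suml; congr (_ / _).
  rewrite (bigD1 T) //= {1}/PT_chain eqxx mulrBr mulr1.
  have := PT_move_balance q halpha hbeta T.
  rewrite (bigD1 T) //= [in RHS](bigD1 T) //= mulrDr => /addrI <-.
  rewrite -[RHS](subrK (\sum_(S | S != T)
    wt alpha beta q S * PT_move_prob alpha beta q S T)).
  congr (_ + _); apply: eq_bigr => S ne_S.
  by rewrite /PT_chain eq_sym (negPf ne_S).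
split=> // pi pi_stationary.
apply: (stationary_unique chain_ge0 chain_sum1 (e := e)
  (m := fun S : permtab M.+1 => height M S)) => // S ne_e.
have [|T lt_T cntT] := @descent_move M S.
  by apply: contraNneq ne_e => eq_e; apply/eqP; apply: val_inj; rewrite /= eq_e.
exists T => //; rewrite /PT_chain ifN; last first.
  by apply: contraTneq lt_T => ->; rewrite ltnn.
rewrite /PT_move_prob divr_gt0 ?ltr0n //.
have nat_ge0 n : 0 <= n%:R :> R by [].
rewrite ltr_wpDr ?mulr_ge0 // ltr_wpDr ?mulr_ge0 // ?ltW //.
move: cntT; rewrite addn_gt0 => /orP[] cnt.
  by rewrite ltr_wpDr // mulr_gt0 // ltr0n.
by rewrite ltr_wpDl ?mulr_ge0 ?ltr0n // ltW.
Qed.
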